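(* Let $\mathbb{K}$ be a field. For every integer $d\geq 5$, there exists a vector $\mathbf{h}=(h_0,h_1,\ldots,h_d)$ of nonzero integers which is the $h$-vector of a pure simplicial complex and such that moreover: (1) $(h_0,h_1,h_2)$ is an $M$-vector, and (2) $\binom{i}{i}h_2+\binom{i+1}{i}h_3+\cdots+\binom{i+d-2}{i}h_d$ is nonnegative for every integer $i$ with $0\leq i\leq 2$, but there is no $(d-1)$-dimensional $(S_2)$ simplicial complex $\Delta$ (over $\mathbb{K}$) with $h(\Delta)=\mathbf{h}$.
   Context: Simplicial complexes are finite, on a vertex set $[n]=\{1,\dots,n\}$ each of whose elements is a vertex (a $0$-dimensional face). A simplicial complex is pure if all its facets (maximal faces) have the same dimension. Let $\mathbb{K}$ be a field and $S=\mathbb{K}[x_1,\dots,x_n]$. For a simplicial complex $\Delta$ on $[n]$, the Stanley--Reisner ideal $I_\Delta\subset S$ is generated by the squarefree monomials $\prod_{i\in F}x_i$ with $F\subseteq[n]$, $F\notin\Delta$, and the Stanley--Reisner ring is $\mathbb{K}[\Delta]=S/I_\Delta$. The $h$-vector of a $(d-1)$-dimensional simplicial complex $\Delta$ is the integer vector $h(\Delta)=(h_0,h_1,\dots,h_d)$ determined by $$\mathrm{Hilb}_{\mathbb{K}[\Delta]}(t)=\sum_{i\ge 0}(\dim_{\mathbb{K}}\mathbb{K}[\Delta]_i)\,t^i=\frac{h_0+h_1t+\cdots+h_dt^d}{(1-t)^d}.$$ (It does not depend on $\mathbb{K}$. A vector with $d+1$ entries is the $h$-vector of a $(d-1)$-dimensional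 complex.) A vector is an $M$-vector if it is the $h$-vector of a Cohen--Macaulay simplicial complex. A finitely generated $S$-module $M$ satisfies Serre's condition $(S_r)$ if $\mathrm{depth}\, M_{\mathfrak p}\ge \min\{r,\dim M_{\mathfrak p}\}$ for every $\mathfrak p\in\mathrm{Spec}(S)$ (the condition being regarded as automatically satisfied when $M_{\mathfrak p}=0$). A simplicial complex $\Delta$ is an $(S_r)$ simplicial complex (over $\mathbb{K}$) if $\mathbb{K}[\Delta]$ satisfies $(S_r)$. *)

(* Defs.v *)
From HB Require Import structures.
From mathcomp Require Import all_boot all_order all_algebra.
From mathcomp Require Import generic_quotient ring_quotient ring.
From mathcomp Require Import mpoly.
From mathcomp Require Import boolp.

Set Implicit Arguments.
Unset Strict Implicit.
Unset Printing Implicit Defensive.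

Import GRing.Theory.
Local Open Scope ring_scope.
Local Open Scope quotient_scope.

Section Denominators.
Variables (R : comNzRingType) (p : prime_idealr R).

Definition denom : Type := {s : R | s \notin (p : pred R)}.
HB.instance Definition _ := Choice.on denom.

Definition dval (s : denom) : R := sval s.

Lemma dvalP (s : denom) : dval s \notin (p : pred R).
Proof. exact: (svalP s). Qed.

Lemma denom1_subproof : 1 \notin (p : pred R).
Proof. by rewrite idealr1. Qed.

Lemma denomM_subproof (s t : denom) : dval s * dval t \notin (p : pred R).
Proof. by rewrite prime_idealrM negb_or !dvalP. Qed.

Definition denom1 : denom :=
  exist (fun s : R => s \notin (p : pred R)) 1 denom1_subproof.
Definition denomM (s t : denom) : denom :=
  exist (fun s : R => s \notin (p : pred R)) (dval s * dval t)
    (denomM_subproof s t).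

End Denominators.

Arguments denom1 {R p}.

Section Localization.
Variables (R : comNzRingType) (p : prime_idealr R) (M : lmodType R).
Implicit Types (m n : M) (s t : denom p).

(* The pair (m, s) stands for the fraction m / s. *)
Definition frac : Type := (M * denom p)%type.
HB.instance Definition _ := Choice.on frac.

Definition frac_eq (x y : frac) : bool :=
  `[< exists u : denom p,
        dval u *: (dval y.2 *: x.1) = dval u *: (dval x.2 *: y.1) >].

Lemma frac_eq_equiv : equiv_class_of frac_eq.
Proof.
split=> [x|x y|y x z].
- by apply/asboolP; exists denom1.
- by apply/asboolP/asboolP => -[u e]; exists u; rewrite e.
move=> /asboolP [u e] /asboolP [v f]; apply/asboolP.
exists (denomM (denomM u v) y.2) => /=.
transitivity ((dval v * dval z.2) *: (dval u *: (dval y.2 *: x.1))).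
  by rewrite !scalerA; congr (_ *: _); ring.
rewrite e.
transitivity ((dval u * dval x.2) *: (dval v *: (dval z.2 *: y.1))).
  by rewrite !scalerA; congr (_ *: _); ring.
by rewrite f !scalerA; congr (_ *: _); ring.
Qed.

Canonical frac_eq_equivRel := EquivRelPack frac_eq_equiv.
Canonical frac_eq_encModRel := defaultEncModRel frac_eq.

Definition localization : Type := {eq_quot frac_eq}.
HB.instance Definition _ := Choice.on localization.
HB.instance Definition _ := EqQuotient.on localization.

Definition mkfrac m s : localization := \pi_localization ((m, s) : frac).

Lemma mkfracP m s n t :
  mkfrac m s = mkfrac n t <->
  exists u : denom p, dval u *: (dval t *: m) = dval u *: (dval s *: n).
Proof.
split; first by move/eqmodP => /asboolP.
by move=> h; apply/eqmodP/asboolP.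
Qed.

Lemma mkfrac_surj (x : localization) : exists m s, x = mkfrac m s.
Proof.
by exists (repr x).1, (repr x).2; rewrite /mkfrac -surjective_pairing reprK.
Qed.

Definition loc0 : localization := mkfrac 0 denom1.
Definition locN (x : localization) : localization :=
  mkfrac (- (repr x).1) (repr x).2.
Definition locD (x y : localization) : localization :=
  mkfrac (dval (repr y).2 *: (repr x).1 + dval (repr x).2 *: (repr y).1)
    (denomM (repr x).2 (repr y).2).

Lemma repr_mkfrac m s : exists u : denom p,
  dval u *: (dval s *: (repr (mkfrac m s)).1) =
  dval u *: (dval (repr (mkfrac m s)).2 *: m).
Proof.
by apply/mkfracP; rewrite {1}/mkfrac -surjective_pairing reprK.
Qed.

Lemma locN_mkfrac m s : locN (mkfrac m s) = mkfrac (- m) s.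
Proof.
apply/mkfracP; have [u e] := repr_mkfrac m s.
by exists u; rewrite !scalerN e.
Qed.

Lemma locD_mkfrac m s n t :
  locD (mkfrac m s) (mkfrac n t) =
  mkfrac (dval t *: m + dval s *: n) (denomM s t).
Proof.
apply/mkfracP.
have [u e] := repr_mkfrac m s; have [v f] := repr_mkfrac n t.
move: (repr (mkfrac m s)) e (repr (mkfrac n t)) f => x e y f.
exists (denomM u v) => /=; rewrite !scalerDr; congr (_ + _).
  transitivity ((dval v * dval t * dval y.2) *: (dval u *: (dval s *: x.1))).
    by rewrite !scalerA; congr (_ *: _); ring.
  by rewrite e !scalerA; congr (_ *: _); ring.
transitivity ((dval u * dval s * dval x.2) *: (dval v *: (dval t *: y.1))).
  by rewrite !scalerA; congr (_ *: _); ring.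
by rewrite f !scalerA; congr (_ *: _); ring.
Qed.

Lemma locDA : associative locD.
Proof.
move=> x y z; have [a [r ->]] := mkfrac_surj x.
have [b [s ->]] := mkfrac_surj y; have [c [t ->]] := mkfrac_surj z.
rewrite !locD_mkfrac; apply/mkfracP; exists denom1 => /=; congr (_ *: _).
rewrite !scalerDr !scalerA !addrA.
by congr (_ *: _ + _ *: _ + _ *: _); ring.
Qed.

Lemma locDC : commutative locD.
Proof.
move=> x y; have [a [r ->]] := mkfrac_surj x.
have [b [s ->]] := mkfrac_surj y.
rewrite !locD_mkfrac; apply/mkfracP; exists denom1 => /=; congr (_ *: _).
rewrite !scalerDr !scalerA addrC.
by congr (_ *: _ + _ *: _); ring.
Qed.

Lemma loc0D : left_id loc0 locD.
Proof.
move=> x; have [a [r ->]] := mkfrac_surj x.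
rewrite locD_mkfrac scaler0 add0r; apply/mkfracP.
by exists denom1 => /=; rewrite mul1r !scale1r.
Qed.

Lemma locND : left_inverse loc0 locN locD.
Proof.
move=> x; have [a [r ->]] := mkfrac_surj x.
rewrite locN_mkfrac locD_mkfrac; apply/mkfracP.
by exists denom1 => /=; rewrite scalerN addNr !scaler0.
Qed.

HB.instance Definition _ :=
  GRing.isZmodule.Build localization locDA locDC loc0D locND.

Lemma mkfracD m s n t :
  mkfrac m s + mkfrac n t = mkfrac (dval t *: m + dval s *: n) (denomM s t).
Proof. exact: locD_mkfrac. Qed.

Lemma mkfracN m s : - mkfrac m s = mkfrac (- m) s.
Proof. exact: locN_mkfrac. Qed.

End Localization.


Section LocalizedAction.
Variables (R : comNzRingType) (p : prime_idealr R).

Definition loc_ring : Type := localization p R^o.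
HB.instance Definition _ := GRing.Zmodule.on loc_ring.
HB.instance Definition _ := EqQuotient.on loc_ring.

Definition ringfrac (a : R) (s : denom p) : loc_ring := @mkfrac R p R^o a s.

Section Action.
(* The action of R_p on M_p; for M = R it is the multiplication of R_p. *)
Variable M : lmodType R.

Definition locZ (x : loc_ring) (y : localization p M) : localization p M :=
  mkfrac (((repr x).1 : R) *: (repr y).1) (denomM (repr x).2 (repr y).2).

Lemma locZ_mkfrac (a : R) (s : denom p) (m : M) (t : denom p) :
  locZ (ringfrac a s) (mkfrac m t) = mkfrac (a *: m) (denomM s t).
Proof.
apply/mkfracP.
have [u e] := @repr_mkfrac R p R^o a s; have [v f] := repr_mkfrac m t.
move: (repr (ringfrac a s)) e => x e; move: (repr (mkfrac m t)) f => y f.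
exists (denomM u v) => /=.
transitivity ((dval u * (dval s * x.1)) *: (dval v *: (dval t *: y.1))).
  by rewrite !scalerA; congr (_ *: _); ring.
rewrite f; have -> : dval u * (dval s * x.1) = dval u * (dval x.2 * a) by exact: e.
by rewrite !scalerA; congr (_ *: _); ring.
Qed.

End Action.

Definition loc_one : loc_ring := ringfrac 1 denom1.
Definition loc_mul (x y : loc_ring) : loc_ring := locZ x y.

Lemma loc_mul_ringfrac a s b t :
  loc_mul (ringfrac a s) (ringfrac b t) = ringfrac (a * b) (denomM s t).
Proof. exact: locZ_mkfrac. Qed.

Lemma ringfrac_surj (x : loc_ring) : exists a s, x = ringfrac a s.
Proof. exact: (@mkfrac_surj R p R^o x). Qed.

Lemma ringfracD a s b t : ringfrac a s + ringfrac b t =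
  ringfrac (dval t * a + dval s * b) (denomM s t).
Proof. exact: (@mkfracD R p R^o a s b t). Qed.

Lemma ringfracP a s b t :
  ringfrac a s = ringfrac b t <->
  exists u : denom p, dval u * (dval t * a) = dval u * (dval s * b).
Proof. exact: (@mkfracP R p R^o a s b t). Qed.

Lemma loc_mulA : associative loc_mul.
Proof.
move=> x y z; have [a [r ->]] := ringfrac_surj x.
have [b [s ->]] := ringfrac_surj y; have [c [t ->]] := ringfrac_surj z.
by rewrite !loc_mul_ringfrac; apply/ringfracP; exists denom1 => /=; ring.
Qed.

Lemma loc_mulC : commutative loc_mul.
Proof.
move=> x y; have [a [r ->]] := ringfrac_surj x.
have [b [s ->]] := ringfrac_surj y.
by rewrite !loc_mul_ringfrac; apply/ringfracP; exists denom1 => /=; ring.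
Qed.

Lemma loc_mul1 : left_id loc_one loc_mul.
Proof.
move=> x; have [a [r ->]] := ringfrac_surj x.
by rewrite !loc_mul_ringfrac; apply/ringfracP; exists denom1 => /=; ring.
Qed.

Lemma loc_mulDl : left_distributive loc_mul +%R.
Proof.
move=> x y z; have [a [r ->]] := ringfrac_surj x.
have [b [s ->]] := ringfrac_surj y; have [c [t ->]] := ringfrac_surj z.
rewrite ringfracD !loc_mul_ringfrac ringfracD.
by apply/ringfracP; exists denom1 => /=; ring.
Qed.

Lemma loc_one_neq0 : loc_one != 0.
Proof.
apply/eqP => /(@ringfracP 1 denom1 0 denom1) [u] /=.
by rewrite !mulr1 !mulr0 => u0; have := dvalP u; rewrite u0 idealr0.
Qed.

HB.instance Definition _ := GRing.Zmodule_isComNzRing.Build loc_ring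
  loc_mulA loc_mulC loc_mul1 loc_mulDl loc_one_neq0.

Variable M : lmodType R.

Lemma locZA (x y : loc_ring) (z : localization p M) :
  locZ x (locZ y z) = locZ (x * y) z.
Proof.
have [a [r ->]] := ringfrac_surj x; have [b [s ->]] := ringfrac_surj y.
have [m [t ->]] := mkfrac_surj z.
rewrite [ringfrac a r * _]loc_mul_ringfrac !locZ_mkfrac.
apply/mkfracP; exists denom1 => /=; rewrite !scalerA.
by congr (_ *: _); ring.
Qed.

Lemma locZ1 : left_id (1 : loc_ring) (@locZ M).
Proof.
move=> z; have [m [t ->]] := mkfrac_surj z.
rewrite (locZ_mkfrac 1 denom1); apply/mkfracP; exists denom1 => /=.
by rewrite !scalerA; congr (_ *: _); ring.
Qed.

Lemma locZDr : right_distributive (@locZ M) +%R.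
Proof.
move=> x y z; have [a [r ->]] := ringfrac_surj x.
have [m [s ->]] := mkfrac_surj y; have [n [t ->]] := mkfrac_surj z.
rewrite mkfracD !locZ_mkfrac mkfracD.
apply/mkfracP; exists denom1 => /=; rewrite !scalerDr !scalerA.
by congr (_ *: _ + _ *: _); ring.
Qed.

Lemma locZDl (z : localization p M) : {morph (@locZ M)^~ z : x y / x + y}.
Proof.
move=> x y; have [a [r ->]] := ringfrac_surj x.
have [b [s ->]] := ringfrac_surj y; have [m [t ->]] := mkfrac_surj z.
rewrite ringfracD !locZ_mkfrac mkfracD.
apply/mkfracP; exists denom1 => /=; rewrite !scalerDl !scalerDr !scalerA.
by congr (_ *: _ + _ *: _); ring.
Qed.

HB.instance Definition _ := GRing.Zmodule_isLmodule.Build loc_ring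
  (localization p M) locZA locZ1 locZDr locZDl.

End LocalizedAction.

Section DepthDim.
Variables (A : comNzRingType) (N : lmodType A).

(* y belongs to the submodule (s_0, s_1, ...) N *)
Definition in_ideal_mul (s : seq A) (y : N) : Prop :=
  exists z : 'I_(size s) -> N, y = \sum_(i < size s) s`_i *: z i.

Definition regular_sequence (s : seq A) : Prop :=
  (forall i y, (i < size s)%N ->
     in_ideal_mul (take i s) (s`_i *: y) -> in_ideal_mul (take i s) y) /\
  (exists y, ~ in_ideal_mul s y).

Definition is_unit (a : A) : Prop := exists b, a * b = 1.

(* For A local (the only use below), the maximal ideal of A consists of the
   non-units, and this says k <= depth N. *)
Definition depth_ge (k : nat) : Prop :=
  exists s : seq A,
    [/\ size s = k, forall a, a \in s -> ~ is_unit a & regular_sequence s].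

Definition in_ann (a : A) : Prop := forall y : N, a *: y = 0.

(* k <= dim N, where dim N is the Krull dimension of A / Ann N; it fails for
   every k when N = 0. *)
Definition dim_ge (k : nat) : Prop :=
  exists P : 'I_k.+1 -> prime_idealr A,
    (forall i a, in_ann a -> a \in (P i : pred A)) /\
    (forall i j : 'I_k.+1, (i < j)%N ->
       {subset (P i : pred A) <= (P j : pred A)} /\
       exists2 a, a \in (P j : pred A) & a \notin (P i : pred A)).

End DepthDim.

Section SerreCM.
Variables (R : comNzRingType) (M : lmodType R).

(* depth M_p >= min {r, dim M_p} for all primes p: both sides are (possibly
   infinite) suprema, so this compares the numbers k below them. *)
Definition serre (r : nat) : Prop :=
  forall (p : prime_idealr R) (k : nat), (k <= r)%N ->
    dim_ge (A := loc_ring p) (localization p M) k ->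
    depth_ge (A := loc_ring p) (localization p M) k.

Definition maximal_ideal (m : idealr R) : Prop :=
  forall J : idealr R, {subset (m : pred R) <= (J : pred R)} ->
    {subset (J : pred R) <= (m : pred R)}.

(* depth M_m = dim M_m for all maximal ideals m (both conditions fail for all
   k when M_m = 0). *)
Definition cohen_macaulay : Prop :=
  forall m : prime_idealr R, maximal_ideal m -> forall k : nat,
    depth_ge (A := loc_ring m) (localization m M) k <->
    dim_ge (A := loc_ring m) (localization m M) k.

End SerreCM.

Section CyclicModule.
Variables (R : comNzRingType) (I : idealr R).

Definition cyclic_module : Type := {ideal_quot I}.
HB.instance Definition _ := GRing.ComNzRing.on cyclic_module.

Definition cyclic_pi (a : R) : cyclic_module := \pi_{ideal_quot I} a.

Definition cyclicZ (a : R) (x : cyclic_module) : cyclic_module :=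
  cyclic_pi a * x.

Lemma cyclicZA a b x : cyclicZ a (cyclicZ b x) = cyclicZ (a * b) x.
Proof. by rewrite /cyclicZ /cyclic_pi rmorphM mulrA. Qed.

Lemma cyclicZ1 : left_id 1 cyclicZ.
Proof. by move=> x; rewrite /cyclicZ /cyclic_pi rmorph1 mul1r. Qed.

Lemma cyclicZDr : right_distributive cyclicZ +%R.
Proof. by move=> a x y; rewrite /cyclicZ mulrDr. Qed.

Lemma cyclicZDl x : {morph cyclicZ^~ x : a b / a + b}.
Proof. by move=> a b; rewrite /cyclicZ /cyclic_pi rmorphD mulrDl. Qed.

HB.instance Definition _ := GRing.Zmodule_isLmodule.Build R cyclic_module
  cyclicZA cyclicZ1 cyclicZDr cyclicZDl.

End CyclicModule.

Record scomplex (n : nat) := SComplex {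
  faces :> {set {set 'I_n}};
  face_empty : set0 \in faces;
  face_vertex : forall i : 'I_n, [set i] \in faces;
  face_sub : forall F G : {set 'I_n}, F \in faces -> G \subset F -> G \in faces
}.

Section ComplexTheory.
Variables (n : nat) (D : scomplex n).

Definition facet (F : {set 'I_n}) : bool := maxset (fun G => G \in faces D) F.

Definition pure : Prop := forall F G, facet F -> facet G -> #|F| = #|G|.

(* dim D + 1, kept in nat since the complex {set0} has dimension -1 *)
Definition rank : nat := \max_(F in faces D) #|F|.

Definition sc_dim : int := rank%:Z - 1.

End ComplexTheory.

Section StanleyReisner.
Variables (K : fieldType) (n : nat) (D : scomplex n).
Local Notation S := {mpoly K[n]}.

Definition sr_ideal : {pred S} := fun f =>
  `[< exists c : {set 'I_n} -> S,
        f = \sum_(F : {set 'I_n} | F \notin faces D) c F * \prod_(i in F) 'X_i >].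

Lemma sr_ideal_closed : idealr_closed sr_ideal.
Proof.
split.
- by apply/asboolP; exists (fun=> 0); rewrite big1 // => F _; rewrite mul0r.
- apply/asboolP => -[c] /(congr1 (meval (fun=> 0 : K))).
  rewrite meval1 raddf_sum big1 /= => [/eqP|F FD]; first by rewrite oner_eq0.
  rewrite mevalM rmorph_prod /=.
  have [F0|[i iF]] := set_0Vmem F; first by rewrite F0 face_empty in FD.
  by rewrite (bigD1 i) //= mevalXU mul0r mulr0.
move=> a f g /asboolP [c ->] /asboolP [e ->]; apply/asboolP.
exists (fun F => a * c F + e F); rewrite mulr_sumr -big_split /=.
by apply: eq_bigr => F _; rewrite mulrA mulrDl.
Qed.

HB.instance Definition _ := isIdealr.Build S sr_ideal sr_ideal_closed.

Definition sr_ring : lmodType S := cyclic_module (sr_ideal : idealr S).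

Definition graded_piece (i : nat) (x : sr_ring) : Prop :=
  exists2 f : S, f \is i.-homog & x = cyclic_pi _ f.

(* dim_K K[D]_i = m, witnessed by a K-basis b; K acts through the constants
   of S. *)
Definition hilbert_function_is (i m : nat) : Prop :=
  exists b : 'I_m -> sr_ring,
    [/\ forall j, graded_piece i (b j),
        forall c : 'I_m -> K,
          \sum_j (c j)%:MP *: b j = 0 -> forall j, c j = 0 &
        forall x, graded_piece i x ->
          exists c : 'I_m -> K, x = \sum_j (c j)%:MP *: b j].

(* h = (h_0, ..., h_d) with d = dim D + 1, and
   (1 - t)^d Hilb(t) = h_0 + h_1 t + ... + h_d t^d as formal power series,
   compared coefficient by coefficient. *)
Definition is_h_vector (h : seq int) : Prop :=
  size h = (rank D).+1 /\
  exists H : nat -> nat, (forall i, hilbert_function_is i (H i)) /\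
    (forall i, \sum_(j < i.+1) ((1 - 'X : {poly int}) ^+ rank D)`_j
                 * (H (i - j)%N)%:Z = h`_i).

Definition serre_complex (r : nat) : Prop := serre sr_ring r.

Definition cm_complex : Prop := cohen_macaulay sr_ring.

End StanleyReisner.

Definition M_vector (K : fieldType) (h : seq int) : Prop :=
  exists (n : nat) (D : scomplex n), cm_complex K D /\ is_h_vector K D h.

(* Main.v *)
(* The vector is h = (1, 2, 1, ..., 1, -1), whose entries sum to d; the third
   inequality in (2) is C(d, 3) >= C(d, 2), which is where d >= 5 comes from.
   An (S_2) complex is pure and any two of its facets are joined by a chain of
   facets meeting in codimension one: otherwise some link of dimension at
   least one is disconnected, and the localization at the corresponding prime
   has depth at most one.  The h-vector h forces exactly d facets of size d;
   along such a chain the common intersection loses at most one vertex per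
   facet, so d facets have a common vertex, the complex is a cone, and
   h_d = 0 instead of -1.
   On the other hand h is the h-vector of the pure complex whose facets are
   the complements of the edges of the disjoint union of an edge and a star
   with d - 1 leaves, and (1, 2, 1) is the h-vector of the 4-cycle.  The
   Stanley-Reisner ring K[x, z]/(xz) (x) K[y, w]/(yw) of the 4-cycle is
   Cohen-Macaulay: at a maximal ideal m, univariate polynomials p, q with
   p(x + z) and q(y + w) in m form a regular sequence, and an algebraic
   dependence between any three elements bounds depth and dimension by 2. *)

From HB Require Import structures.
Require Import Defs.
From mathcomp Require Import all_boot all_order all_algebra.
From mathcomp Require Import generic_quotient ring_quotient ring zify mpoly boolp.

Set Implicit Arguments.
Unset Strict Implicit.
Unset Printing Implicit Defensive.

Import GRing.Theory Num.Theory.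
Local Open Scope ring_scope.

(** * Ideals and localizations of cyclic modules *)

(** The field is arbitrary and the Cohen-Macaulay condition is tested at every maximal ideal, so the
    maximal ideals of the 4-cycle need be neither graded nor rational points. This is why linear
    forms do not suffice: a two-generator case of Zariski's lemma has to produce p and q, and the
    upper bound 2 has to hold for arbitrary elements. All statements about localizations are first
    pulled back to congruences in the ring itself, up to denominators.

    The Hilbert series is the sum of t^|F| / (1 - t)^|F| over the faces. Hence h(1) counts the faces
    of maximal size. The sum d of the entries is the threshold value: d facets of size d lose at
    most d - 1 vertices, while the d + 1 facets of the boundary of a d-simplex have no common
    vertex. In the pure example the complements of two edges meet in codimension one exactly when
    the edges share a vertex, so the disconnected graph breaks the chains of facets, and no vertex
    is common because every vertex lies on an edge. *)

Section Ideals.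
Variable R : comNzRingType.

Definition is_domain (T : comNzRingType) : Prop :=
  forall x y : T, x * y = 0 -> (x == 0) || (y == 0).

Definition kernel (T : comNzRingType) (f : R -> T) : {pred R} :=
  fun a => f a == 0.

Lemma kernel_ideal (T : comNzRingType) (f : {rmorphism R -> T}) :
  idealr_closed (kernel f).
Proof.
split; rewrite ?unfold_in ?rmorph0 ?rmorph1 ?oner_eq0 //.
by move=> a u v; rewrite !unfold_in rmorphD rmorphM => /eqP-> /eqP->; rewrite mulr0 addr0.
Qed.

Lemma kernel_prime (T : comNzRingType) (f : {rmorphism R -> T}) :
  is_domain T -> prime_idealr_closed (kernel f).
Proof. by move=> dT u v; rewrite !unfold_in rmorphM => /eqP /dT. Qed.

Definition ker_prime (T : comNzRingType) (f : {rmorphism R -> T})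
    (dT : is_domain T) : prime_idealr R :=
  HB.pack_for (prime_idealr R) (kernel f : R -> bool)
    (isIdealr.Build R (kernel f) (kernel_ideal f))
    (isPrimeIdealrClosed.Build R (kernel f) (kernel_prime dT)).

Lemma mem_ker_prime (T : comNzRingType) (f : {rmorphism R -> T})
    (dT : is_domain T) (a : R) : (a \in (ker_prime f dT : pred R)) = (f a == 0).
Proof. by []. Qed.

Definition adjoin_pred (I : idealr R) (a : R) : {pred R} :=
  fun b => `[< exists c, b - c * a \in (I : pred R) >].

(** An [idealr] is proper by definition; the hypothesis says that 1 stays outside the ideal
    generated by [I] and [a]. *)
Lemma adjoin_closed (I : idealr R) (a : R) :
  (forall c, 1 - c * a \notin (I : pred R)) -> idealr_closed (adjoin_pred I a).
Proof.
move=> h; split.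
- by apply/asboolP; exists 0; rewrite mul0r subr0 idealr0.
- by apply/asboolP => -[c]; apply/negP.
move=> b u v /asboolP [c hc] /asboolP [e he]; apply/asboolP.
exists (b * c + e); rewrite (_ : _ - _ = b * (u - c * a) + (v - e * a)); last by ring.
by rewrite rpredD ?idealMr.
Qed.

Definition adjoin (I : idealr R) (a : R)
    (h : forall c, 1 - c * a \notin (I : pred R)) : idealr R :=
  HB.pack_for (idealr R) (adjoin_pred I a : R -> bool)
    (isIdealr.Build R (adjoin_pred I a) (adjoin_closed h)).

Lemma mem_adjoin (I : idealr R) (a : R)
    (h : forall c, 1 - c * a \notin (I : pred R)) (b : R) :
  b \in (adjoin h : pred R) <-> exists c, b - c * a \in (I : pred R).
Proof. by split=> [/asboolP|e] //; apply/asboolP. Qed.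

Definition quot_pi (I : idealr R) (a : R) : {ideal_quot I} :=
  (\pi_{ideal_quot I} a)%qT.

HB.instance Definition _ (I : idealr R) :=
  GRing.RMorphism.copy (@quot_pi I) (\pi_{ideal_quot I})%qT.

Lemma quot_pi_eq0 (I : idealr R) (a : R) :
  (quot_pi I a == 0) = (a \in (I : pred R)).
Proof.
rewrite -[a in RHS]subr0 Quotient.idealrBE -[0 in LHS](rmorph0 (quot_pi I)).
by [].
Qed.

Lemma quot_pi_surj (I : idealr R) (x : {ideal_quot I}) : exists a, x = quot_pi I a.
Proof. by exists (repr x); rewrite /quot_pi reprK. Qed.

Lemma quot_domain (I : prime_idealr R) : is_domain {ideal_quot I}.
Proof. exact: Quotient.rquot_IdomainAxiom. Qed.

(** Otherwise adjoining [a] to [m] would give a larger proper ideal. *)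
Lemma maximal_inv (m : idealr R) : maximal_ideal m -> forall a, a \notin (m : pred R) ->
  exists c, 1 - c * a \in (m : pred R).
Proof.
move=> mmax a am; apply: contrapT => hn.
have h c : 1 - c * a \notin (m : pred R) by apply/negP => hc; apply: hn; exists c.
move/negP: am; apply; apply: (mmax (adjoin h)).
  by move=> b bm; apply/mem_adjoin; exists 0; rewrite mul0r subr0.
by apply/mem_adjoin; exists 1; rewrite mul1r subrr idealr0.
Qed.

End Ideals.

Section CyclicTheory.
Variables (R : comNzRingType) (I : idealr R).

Lemma cyclic_pi_eq0 (a : R) : cyclic_pi I a = 0 <-> a \in (I : pred R).
Proof. by rewrite -quot_pi_eq0; split=> [e|/eqP //]; apply/eqP. Qed.

Lemma cyclic_piB (a b : R) : cyclic_pi I (a - b) = cyclic_pi I a - cyclic_pi I b.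
Proof. exact: (rmorphB (quot_pi I)). Qed.

Lemma cyclic_piZ (a b : R) : a *: cyclic_pi I b = cyclic_pi I (a * b).
Proof. exact: (esym (rmorphM (quot_pi I) a b)). Qed.

Lemma cyclic_pi_surj (x : cyclic_module I) : exists a, x = cyclic_pi I a.
Proof. exact: (@quot_pi_surj _ I). Qed.

End CyclicTheory.

Section LocalQuotient.
Variables (R : comNzRingType) (p : prime_idealr R) (I : idealr R).
Local Notation N := (localization p (cyclic_module I)).

Lemma mkfrac_surj_cyclic (y : N) : exists x s, y = mkfrac (cyclic_pi I x) s.
Proof.
have [m [s ->]] := mkfrac_surj y; have [x ->] := cyclic_pi_surj m.
by exists x, s.
Qed.

Lemma mkfrac_eq0 (x : R) (s : denom p) : mkfrac (cyclic_pi I x) s = 0 <->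
  exists2 u, u \notin (p : pred R) & u * x \in (I : pred R).
Proof.
split=> [/mkfracP [u]|[u up ux]].
  rewrite scale1r !scaler0 cyclic_piZ => /cyclic_pi_eq0 h.
  by exists (dval u) => //; apply: dvalP.
apply/mkfracP; exists (exist _ u up); rewrite scale1r !scaler0 cyclic_piZ.
exact/cyclic_pi_eq0.
Qed.

Definition loc_map (a : R) : loc_ring p := ringfrac a denom1.

Lemma loc_map_zmod : zmod_morphism loc_map.
Proof.
move=> a b; apply: (addIr (loc_map b)); rewrite addrNK /loc_map ringfracD.
by apply/ringfracP; exists denom1 => /=; ring.
Qed.

Lemma loc_map_monoid : monoid_morphism loc_map.
Proof.
split=> // a b; rewrite /loc_map [RHS]loc_mul_ringfrac.
by apply/ringfracP; exists denom1 => /=; ring.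
Qed.

HB.instance Definition _ := GRing.isZmodMorphism.Build R (loc_ring p) loc_map
  loc_map_zmod.
HB.instance Definition _ := GRing.isMonoidMorphism.Build R (loc_ring p) loc_map
  loc_map_monoid.

Lemma loc_map_unit (s : denom p) : loc_map (dval s) * ringfrac 1 s = 1.
Proof.
rewrite [LHS]loc_mul_ringfrac; apply/ringfracP; exists denom1 => /=; ring.
Qed.

Lemma ringfracE (a : R) (s : denom p) : ringfrac a s = ringfrac 1 s * loc_map a.
Proof.
rewrite [RHS]loc_mul_ringfrac; apply/ringfracP; exists denom1 => /=; ring.
Qed.

Lemma ringfrac_unitP (a : R) (s : denom p) :
  ~ is_unit (ringfrac a s) <-> a \in (p : pred R).
Proof.
split=> [nu|ap].
  apply: contrapT => /negP ap; apply: nu; exists (ringfrac (dval s) (exist _ a ap)).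
  rewrite [LHS]loc_mul_ringfrac; apply/ringfracP; exists denom1 => /=; ring.
case=> z; have [b [t ->]] := ringfrac_surj z; rewrite [_ * _]loc_mul_ringfrac.
case/ringfracP => u /=; rewrite mul1r mulr1 => e.
have: dval u * (dval s * dval t) \in (p : pred R).
  by rewrite -e; apply: idealMr; rewrite mulrC; apply: idealMr.
by rewrite !prime_idealrM !(negPf (dvalP _)).
Qed.

(* The image of [x] in the localization [N] of [R / I] at [p] lies in the
   submodule generated by [t]; membership in [I] itself is also up to a
   denominator. *)
Fixpoint in_gen (t : seq R) (x : R) : Prop :=
  if t is a :: t' then exists2 v, v \notin (p : pred R) & exists c, in_gen t' (v * x - a * c)
  else exists2 u, u \notin (p : pred R) & u * x \in (I : pred R).

(** [in_gen] peels generators off the front, whereas regular sequences grow at the back; the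
    multiple of [a] is carried past every denominator. *)
Lemma in_gen_rcons (t : seq R) (a x c : R) : in_gen t (x + c * a) -> in_gen (rcons t a) x.
Proof.
elim: t x c => [|b t IH] x c /=.
  case=> u up h; exists u => //; exists (- (u * c)), 1; first by rewrite idealr1.
  suff -> : 1 * (u * x - a * - (u * c)) = u * (x + c * a) by []; ring.
case=> v vp [e h]; exists v => //; exists e; apply: (IH _ (v * c)).
suff -> : v * x - b * e + v * c * a = v * (x + c * a) - b * e by []; ring.
Qed.

Lemma in_genW (t : seq R) (a x : R) : in_gen t x -> in_gen (rcons t a) x.
Proof. by move=> h; apply: (in_gen_rcons (c := 0)); rewrite mul0r addr0. Qed.

Lemma in_genM (t : seq R) (a x : R) : in_gen t x -> in_gen t (a * x).
Proof.
elim: t x => [|b t IH] x /=.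
  by case=> u up h; exists u => //; rewrite mulrCA idealMr.
case=> v vp [e h]; exists v => //; exists (a * e).
by rewrite (_ : _ - _ = a * (v * x - b * e)); [exact: IH|ring].
Qed.

Lemma in_gen_cancel (t : seq R) (a x : R) : a \notin (p : pred R) ->
  in_gen t (a * x) -> in_gen t x.
Proof.
case: t => [|b t] ap /=.
  case=> u up h; exists (u * a); last by rewrite -mulrA.
  by rewrite prime_idealrM negb_or up.
case=> v vp [e h]; exists (v * a); first by rewrite prime_idealrM negb_or vp.
by exists e; rewrite -mulrA.
Qed.

Lemma in_ideal_mul_nil (A : comNzRingType) (L : lmodType A) (y : L) :
  in_ideal_mul [::] y <-> y = 0.
Proof.
split=> [[z ->]|->]; first by rewrite big_ord0.
by exists (fun=> 0); rewrite big_ord0.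
Qed.

Lemma in_ideal_mul_cons (A : comNzRingType) (L : lmodType A) (a : A) s (y : L) :
  in_ideal_mul (a :: s) y <-> exists z, in_ideal_mul s (y - a *: z).
Proof.
split=> [[z ->]|[z0 [z e]]].
  exists (z ord0), (fun i => z (lift ord0 i)).
  by rewrite big_ord_recl /= addrC addKr.
exists (fun i => if unlift ord0 i is Some j then z j else z0).
rewrite big_ord_recl unlift_none /= -[LHS](addrNK (a *: z0)) e addrC; congr (_ + _).
by apply: eq_bigr => i _; rewrite liftK.
Qed.

(** Denominators are units of the localization, so only numerators matter. *)
Lemma in_ideal_mul_loc (q : seq (R * denom p)) (x : R) (s : denom p) :
  in_ideal_mul [seq ringfrac z.1 z.2 | z <- q] (mkfrac (cyclic_pi I x) s : N) <->
  in_gen (map fst q) x.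
Proof.
elim: q x s => [|[a r] q IH] x s.
  by rewrite in_ideal_mul_nil; apply: mkfrac_eq0.
have step c t : (mkfrac (cyclic_pi I x) s : N) - ringfrac a r *: mkfrac (cyclic_pi I c) t
    = mkfrac (cyclic_pi I (dval r * dval t * x - a * (dval s * c))) (denomM s (denomM r t)).
  rewrite [_ *: _]locZ_mkfrac mkfracN mkfracD scalerN !cyclic_piZ -cyclic_piB.
  by congr (mkfrac (cyclic_pi I _) _) => /=; ring.
rewrite [map _ _]/= in_ideal_mul_cons [map _ _]/= [in_gen _ _]/=.
split=> [[z]|[v vp [c h]]].
  have [c [t ->]] := mkfrac_surj_cyclic z; rewrite step => /IH h.
  exists (dval r * dval t); last by exists (dval s * c).
  by rewrite prime_idealrM negb_or !dvalP.
exists (mkfrac (cyclic_pi I (dval r * c)) (denomM s (exist _ v vp))).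
rewrite step; apply/IH => /=.
rewrite (_ : _ - _ = dval r * dval s * (v * x - a * c)); last by rewrite /dval /=; ring.
exact: in_genM.
Qed.

(** A regular sequence may be replaced by its numerators, and a fraction is a non-unit exactly when
    its numerator lies in [p]. Depth thus becomes a statement about elements of [R]. *)
Lemma depth_ge_loc (k : nat) : depth_ge (A := loc_ring p) N k <->
  exists t : seq R, [/\ size t = k, forall a, a \in t -> a \in (p : pred R),
    forall i x, (i < size t)%N -> in_gen (take i t) (t`_i * x) -> in_gen (take i t) x
    & exists x, ~ in_gen t x].
Proof.
split=> [[s [sz nu [reg [y hy]]]]|[t [sz tp reg [x hx]]]].
  have [q qE] : exists q : seq (R * denom p), s = [seq ringfrac z.1 z.2 | z <- q].
    elim: s {sz nu reg hy} => [|b s [q ->]]; first by exists [::].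
    by have [a [r ->]] := ringfrac_surj b; exists ((a, r) :: q).
  rewrite qE size_map in sz nu reg hy; exists (map fst q); split.
  - by rewrite size_map.
  - move=> _ /mapP [[a r] zq ->] /=; apply/(ringfrac_unitP a r); apply: nu.
    by apply/mapP; exists (a, r).
  - move=> i x; rewrite size_map => iq; have := reg i (mkfrac (cyclic_pi I x) denom1).
    rewrite -!map_take in_ideal_mul_loc => /(_ iq); rewrite (nth_map (0, denom1)) //.
    rewrite [_ *: _]locZ_mkfrac cyclic_piZ in_ideal_mul_loc.
    by rewrite (nth_map (0, denom1)).
  have [x [r yE]] := mkfrac_surj_cyclic y; exists x => h; apply: hy.
  by rewrite yE; apply/in_ideal_mul_loc.
pose q := [seq (a, denom1 : denom p) | a <- t].
have qE : map fst q = t by rewrite -map_comp map_id.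
have lE : map loc_map t = [seq ringfrac z.1 z.2 | z <- q] by rewrite -map_comp.
exists (map loc_map t); split; first by rewrite size_map.
  by move=> _ /mapP [a ta ->]; apply/ringfrac_unitP/tp.
split; last first.
  by exists (mkfrac (cyclic_pi I x) denom1); rewrite lE in_ideal_mul_loc qE.
move=> i y; rewrite size_map => it; have [z [r ->]] := mkfrac_surj_cyclic y.
rewrite (nth_map 0) // lE -map_take [_ *: _]locZ_mkfrac cyclic_piZ !in_ideal_mul_loc.
by rewrite map_take qE; apply: reg.
Qed.
End LocalQuotient.

Section ExtendedPrimes.
Variables (R : comNzRingType) (p : prime_idealr R).

Definition ext_pred (Q : prime_idealr R) : {pred loc_ring p} :=
  fun x => `[< exists2 a, a \in (Q : pred R) & exists s, x = ringfrac a s >].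

Section Extension.
Variables (Q : prime_idealr R) (Qp : {subset (Q : pred R) <= (p : pred R)}).

Lemma denomN (s : denom p) : dval s \notin (Q : pred R).
Proof. by apply/negP => /Qp; rewrite (negPf (dvalP s)). Qed.

Lemma mem_ext_pred (a : R) (s : denom p) :
  (ringfrac a s \in ext_pred Q) = (a \in (Q : pred R)).
Proof.
apply/asboolP/idP => [[b bQ [t /ringfracP [u e]]]|aQ]; last by exists a; last exists s.
have: dval u * (dval t * a) \in (Q : pred R).
  by rewrite e; apply/idealMr/idealMr.
by rewrite !prime_idealrM !(negPf (denomN _)).
Qed.

Lemma ext_ideal : idealr_closed (ext_pred Q).
Proof.
split.
- by rewrite -(rmorph0 (@loc_map R p)) mem_ext_pred idealr0.
- by rewrite -(rmorph1 (@loc_map R p)) mem_ext_pred idealr1.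
move=> x y z; have [a [r ->]] := ringfrac_surj x; have [b [s ->]] := ringfrac_surj y.
have [c [t ->]] := ringfrac_surj z; rewrite [_ * _]loc_mul_ringfrac ringfracD.
rewrite !mem_ext_pred => bQ cQ; apply: rpredD; last exact: idealMr.
by rewrite mulrA idealMr.
Qed.

Lemma ext_prime : prime_idealr_closed (ext_pred Q).
Proof.
move=> x y; have [a [r ->]] := ringfrac_surj x; have [b [s ->]] := ringfrac_surj y.
by rewrite [_ * _]loc_mul_ringfrac !mem_ext_pred prime_idealrM.
Qed.

Definition extension : prime_idealr (loc_ring p) :=
  HB.pack_for (prime_idealr (loc_ring p)) (ext_pred Q : loc_ring p -> bool)
    (isIdealr.Build (loc_ring p) (ext_pred Q) ext_ideal)
    (isPrimeIdealrClosed.Build (loc_ring p) (ext_pred Q) ext_prime).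

End Extension.

Lemma dim_ge_chain (I : idealr R) (k : nat) (Q : 'I_k.+1 -> prime_idealr R) :
  (forall i, {subset (I : pred R) <= (Q i : pred R)}) ->
  (forall i, {subset (Q i : pred R) <= (p : pred R)}) ->
  (forall i j : 'I_k.+1, (i < j)%N -> {subset (Q i : pred R) <= (Q j : pred R)} /\
     exists2 a, a \in (Q j : pred R) & a \notin (Q i : pred R)) ->
  dim_ge (A := loc_ring p) (localization p (cyclic_module I)) k.
Proof.
move=> IQ Qp Qlt; exists (fun i => extension (Qp i)); split=> [i x|i j /Qlt [sQ [a aj ai]]].
  have [a [s ->]] := ringfrac_surj x => ann; rewrite [_ \in _]mem_ext_pred //.
  (* Annihilating the class of 1 already puts some [u * a] with [u] outside [p] into [I], hence into
     the prime [Q i], which does not contain [u]. *)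
  have := ann (mkfrac (cyclic_pi I 1) denom1); rewrite [_ *: _]locZ_mkfrac cyclic_piZ mulr1.
  move/mkfrac_eq0 => [u up /(IQ i)]; rewrite prime_idealrM => /orP [/Qp|//].
  by rewrite (negPf up).
split=> [x|]; last by exists (loc_map p a); rewrite [_ \in _]mem_ext_pred.
by have [b [s ->]] := ringfrac_surj x; rewrite ![_ \in extension _]mem_ext_pred //; apply: sQ.
Qed.

End ExtendedPrimes.

Lemma dim_geW (A : comNzRingType) (L : lmodType A) (k l : nat) : (k <= l)%N ->
  dim_ge L l -> dim_ge L k.
Proof.
move=> kl [P [Pann Plt]]; have kl1 : (k.+1 <= l.+1)%N by [].
exists (fun i => P (widen_ord kl1 i)); split=> [i|i j ij]; first exact: Pann.
exact: Plt.
Qed.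

(** * Depth and dimension bounds from explicit relations *)

Section LexRelation.
Variables (R : comNzRingType) (p : prime_idealr R) (I : idealr R).
Local Notation N := (localization p (cyclic_module I)).

Lemma in_gen_take (l : nat) (t : seq R) (x : R) :
  in_gen p I (take l t) x -> in_gen p I t x.
Proof.
elim: t l x => [|b t IH] [|l] x //=; last first.
  by case=> v vp [c h]; exists v => //; exists c; apply: IH h.
case=> u up h; exists u => //; exists 0; rewrite mulr0 subr0; apply: (IH 0%N); rewrite take0.
by exists 1; rewrite ?idealr1 // mul1r.
Qed.

Lemma depth_geW (k l : nat) : (k <= l)%N ->
  depth_ge (A := loc_ring p) N l -> depth_ge (A := loc_ring p) N k.
Proof.
move=> kl /depth_ge_loc [t [sz tp reg [x hx]]]; apply/depth_ge_loc.
have szk : size (take k t) = k by rewrite size_takel ?sz.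
exists (take k t); split=> // [a /mem_take|i y|]; first exact: tp.
  rewrite szk => ik; rewrite nth_take // take_takel; last exact: ltnW.
  by apply: reg; rewrite sz; apply: leq_trans kl.
by exists x => /in_gen_take.
Qed.

(** Regularity of [a] modulo [I] and of [b] modulo [I] and [a] survives localization, since
    denominators are absorbed into [f]. The quotient does not vanish because [p] contains [I], [a]
    and [b]. *)
Lemma depth_ge2_intro (a b : R) :
  {subset (I : pred R) <= (p : pred R)} -> a \in (p : pred R) -> b \in (p : pred R) ->
  (forall f, a * f \in (I : pred R) -> f \in (I : pred R)) ->
  (forall f c, b * f - c * a \in (I : pred R) -> exists c', f - c' * a \in (I : pred R)) ->
  depth_ge (A := loc_ring p) N 2.
Proof.
move=> Ip ap bp rega regb.
have prodp u w : u \notin (p : pred R) -> w \notin (p : pred R) -> u * w \notin (p : pred R).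
  by move=> up wp; rewrite prime_idealrM negb_or up.
apply/depth_ge_loc; exists [:: a; b]; split=> //.
- by move=> f; rewrite !inE => /orP [] /eqP ->.
- case=> [|[|//]] x _ /=.
    by case=> u up h; exists u => //; apply: rega; rewrite mulrCA.
  case=> w wp [c [u up h]]; exists (u * w); first exact: prodp.
  have [c' hc'] : exists c', u * w * x - c' * a \in (I : pred R).
    by apply: (regb _ (u * c)); rewrite (_ : _ - _ = u * (w * (b * x) - a * c)) //; ring.
  by exists c', 1; rewrite ?idealr1 // mul1r [_ * c']mulrC.
exists 1 => /= -[w wp [c [w' wp' [c' [u up /Ip]]]]].
rewrite prime_idealrM (negPf up) mulr1 /= => h.
have: w' * w \in (p : pred R).
  rewrite (_ : _ * _ = (w' * (w - a * c) - b * c') + (w' * c * a + c' * b)); last by ring.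
  by apply: rpredD => //; apply: rpredD; apply: idealMr.
by rewrite (negPf (prodp _ _ wp' wp)).
Qed.

(* The relation attached to the lexicographically smallest monomial of an
   algebraic dependence; it bounds both the length of chains of primes
   (Coquand-Lombardi) and the length of regular sequences. *)
Definition lex_relation (a1 a2 a3 : R) : Prop :=
  exists m1 m2 m3 c1 c2 c3,
    a1 ^+ m1 * (a2 ^+ m2 * (a3 ^+ m3 * (1 + c3 * a3) + c2 * a2) + c1 * a1)
      \in (I : pred R).

Hypothesis lexI : forall a1 a2 a3, lex_relation a1 a2 a3.

(** Cancelling the power of [a1], then that of [a2] modulo [a1], then that of [a3] modulo both
    leaves [1 + c3 * a3]. This is a unit at [p], so [a1] and [a2] already generate everything. *)
Lemma lex_depth_lt3 : ~ depth_ge (A := loc_ring p) N 3.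
Proof.
move=> /depth_ge_loc [t [sz tp reg [x hx]]].
case: t sz tp reg hx => [|a1 [|a2 [|a3 [|? ?]]]] // _ tp reg; apply.
have regX i m y : (i < 3)%N -> in_gen p I (take i [:: a1; a2; a3]) ([:: a1; a2; a3]`_i ^+ m * y) ->
    in_gen p I (take i [:: a1; a2; a3]) y.
  move=> i3; elim: m => [|m IH]; first by rewrite expr0 mul1r.
  by rewrite exprS -mulrA => /reg /IH; apply.
have [m1 [m2 [m3 [c1 [c2 [c3 h]]]]]] := lexI a1 a2 a3.
have h0 : in_gen p I [::] (a2 ^+ m2 * (a3 ^+ m3 * (1 + c3 * a3) + c2 * a2) + c1 * a1).
  by apply: (regX 0%N m1) => //; exists 1; rewrite ?idealr1 // mul1r.
have h1 := regX 1%N m2 _ isT (in_gen_rcons h0).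
have h2 := regX 2%N m3 _ isT (in_gen_rcons h1).
have h3 : in_gen p I [:: a1; a2] 1.
  apply: (in_gen_cancel (a := 1 + c3 * a3)); last by rewrite mulr1.
  apply/negP => h4; have := idealr1 p.
  rewrite -(addrK (c3 * a3) 1) rpredB // idealMr //.
  by apply: tp; rewrite !inE eqxx !orbT.
by rewrite -(mulr1 x); apply/(in_genM x)/(in_genW a3 h3).
Qed.

(** The same peeling along a chain of four primes: each [a_i] lies in the i-th prime but not in the
    one before, and the relation ends by putting 1 into the last prime. *)
Lemma lex_dim_lt3 : ~ dim_ge (A := loc_ring p) N 3.
Proof.
move=> [P [Pann Plt]].
(* Fractions [1 / s] are units, so the elements separating the primes can be taken from [R]. *)
have P_unit (i : 'I_4) (s : denom p) x : (ringfrac 1 s * x \in (P i : pred _)) = (x \in (P i : pred _)).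
  rewrite prime_idealrM; case: (boolP (ringfrac 1 s \in _)) => //= h.
  by have := idealMr (loc_map p (dval s)) h; rewrite loc_map_unit idealr1.
have num (i j : 'I_4) : (i < j)%N -> exists2 a, loc_map p a \in (P j : pred _) & loc_map p a \notin (P i : pred _).
  move=> ij; have [_ [x xj xi]] := Plt _ _ ij; have [a [s xE]] := ringfrac_surj x.
  by exists a; [move: xj|move: xi]; rewrite xE ringfracE P_unit.
have [a1 a11 a10] := num 0 1 isT; have [a2 a22 a21] := num 1 2%:R isT.
have [a3 a33 a32] := num 2%:R 3%:R isT.
have powP (i : 'I_4) a m x : loc_map p a \notin (P i : pred _) ->
    loc_map p (a ^+ m * x) \in (P i : pred _) -> loc_map p x \in (P i : pred _).
  move=> ha; elim: m => [|m IH]; first by rewrite expr0 mul1r.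
  by rewrite exprS -mulrA rmorphM prime_idealrM (negPf ha).
have step (i j : 'I_4) a c x : (i < j)%N -> loc_map p a \in (P j : pred _) ->
    loc_map p (x + c * a) \in (P i : pred _) -> loc_map p x \in (P j : pred _).
  move=> /Plt [sub _] ha /sub; rewrite rmorphD rmorphM => h.
  by rewrite -(addrK (loc_map p c * loc_map p a) (loc_map p x)) rpredB // idealMr.
have [m1 [m2 [m3 [c1 [c2 [c3 h]]]]]] := lexI a1 a2 a3.
have h0 : loc_map p (a1 ^+ m1 * (a2 ^+ m2 * (a3 ^+ m3 * (1 + c3 * a3) + c2 * a2) + c1 * a1))
    \in (P 0 : pred _).
  apply: Pann => y; have [x [s ->]] := mkfrac_surj_cyclic y.
  rewrite [_ *: _]locZ_mkfrac cyclic_piZ; apply/mkfrac_eq0.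
  by exists 1; rewrite ?idealr1 // mul1r mulrC idealMr.
have h1 := powP 1 _ _ _ a21 (step 0 1 _ _ _ isT a11 (powP 0 _ _ _ a10 h0)).
have h2 := powP 2%:R _ _ _ a32 (step 1 2%:R _ _ _ isT a22 h1).
have := step 2%:R 3%:R _ _ _ isT a33 h2.
by rewrite rmorph1 idealr1.
Qed.

End LexRelation.

(** * Face primes of a Stanley-Reisner ring *)

Lemma mpoly_rmorph_ext (K : nzRingType) (n : nat) (T : comNzRingType)
    (f g : {rmorphism {mpoly K[n]} -> T}) :
  (forall c, f c%:MP = g c%:MP) -> (forall i, f 'X_i = g 'X_i) -> f =1 g.
Proof.
move=> fgC fgX p; rewrite (mpolyE p) !rmorph_sum; apply: eq_bigr => m _.
rewrite -mul_mpolyC !rmorphM fgC mpolyXE_id !rmorph_prod; congr (_ * _).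
by apply: eq_bigr => i _; rewrite !rmorphXn fgX.
Qed.

Section FacePrimes.
Variables (K : fieldType) (n : nat).
Local Notation S := {mpoly K[n]}.
Implicit Types (m : 'X_{1..n}) (F G V W : {set 'I_n}).

Definition mnm_set F : 'X_{1..n} := [multinom (i \in F : nat) | i < n].
Definition mnm_supp m : {set 'I_n} := [set i | m i != 0%N].

Lemma prodX_mnm_set F : \prod_(i in F) 'X_i = 'X_[mnm_set F] :> S.
Proof.
rewrite mpolyXE_id big_mkcond /=; apply: eq_bigr => i _.
by rewrite mnmE; case: (i \in F).
Qed.

Lemma mnm_set_le F m : (mnm_set F <= m)%MM = (F \subset mnm_supp m).
Proof.
apply/mnm_lepP/subsetP => [h i iF|h i]; first by have := h i; rewrite mnmE iF inE -lt0n.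
by rewrite mnmE; case: (boolP (i \in F)) => // /h; rewrite inE -lt0n.
Qed.

Definition face_subst W : S -> S := mmap (@mpolyC n K) (fun i => if i \in W then 'X_i else 0).

HB.instance Definition _ W := GRing.RMorphism.copy (face_subst W)
  (mmap (@mpolyC n K) (fun i => if i \in W then 'X_i else 0)).

Lemma face_substX W i : face_subst W 'X_i = if i \in W then 'X_i else 0.
Proof. by rewrite /face_subst mmapX mmap1U. Qed.

Lemma face_substC W c : face_subst W c%:MP = c%:MP.
Proof. exact: mmapC. Qed.

Lemma face_substXm W m : face_subst W 'X_[m] = if mnm_supp m \subset W then 'X_[m] else 0.
Proof.
rewrite mpolyXE_id rmorph_prod; case: ifPn => [/subsetP mW|/subsetPn [i im iW]].
  apply: eq_bigr => i _; rewrite rmorphXn /= face_substX.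
  have [->|mi] := eqVneq (m i) 0%N; first by rewrite !expr0.
  by rewrite mW // inE.
rewrite (bigD1 i) //= rmorphXn /= face_substX (negPf iW) expr0n.
by move: im; rewrite inE => /negPf ->; rewrite mul0r.
Qed.

Lemma face_subst_sub V W f : V \subset W ->
  face_subst V (face_subst W f) = face_subst V f.
Proof.
move=> /subsetP VW; apply: (mpoly_rmorph_ext (f := face_subst V \o face_subst W)) => [c|i] /=.
  by rewrite !face_substC.
rewrite !face_substX; case: ifPn => [iW|iW]; rewrite ?face_substX //.
by rewrite raddf0; case: ifP => // /VW; rewrite (negPf iW).
Qed.

Lemma mpoly_domain : is_domain S.
Proof. exact: mpoly_idomainAxiom. Qed.

(** This is the prime generated by the variables outside [W]; taking it as a kernel makes membership
    a computation. *)
Definition face_prime W : prime_idealr S := ker_prime (face_subst W) mpoly_domain.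

Lemma mem_face_prime W f : (f \in (face_prime W : pred S)) = (face_subst W f == 0).
Proof. exact: mem_ker_prime. Qed.

Lemma mem_face_primeX W i : ('X_i \in (face_prime W : pred S)) = (i \notin W).
Proof.
rewrite mem_face_prime face_substX; case: ifP => _; rewrite ?eqxx //.
by apply/negbTE; rewrite -msize_poly_eq0 msizeX mdeg1.
Qed.

Lemma face_prime_sub V W : V \subset W ->
  {subset (face_prime W : pred S) <= (face_prime V : pred S)}.
Proof.
move=> VW f fW; have /eqP f0 : face_subst W f == 0 by rewrite -mem_face_prime.
by rewrite mem_face_prime -(face_subst_sub f VW) f0 raddf0.
Qed.

Lemma face_subst_diff W f : exists c : 'I_n -> S,
  f - face_subst W f = \sum_(i | i \notin W) c i * 'X_i.
Proof.
elim/mpolyind: f => [|a m p _ _ [c e]].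
  by exists (fun=> 0); rewrite raddf0 subrr big1 // => i _; rewrite mul0r.
have [b eb] : exists b : 'I_n -> S,
    'X_[m] - face_subst W 'X_[m] = \sum_(i | i \notin W) b i * 'X_i.
  rewrite face_substXm; case: ifPn => [_|/subsetPn [i im iW]].
    by exists (fun=> 0); rewrite subrr big1 // => i _; rewrite mul0r.
  exists (fun j => if j == i then 'X_[m - U_(i)] else 0).
  rewrite (bigD1 i) //= eqxx big1 => [|j /andP [_ /negPf ->]]; last by rewrite mul0r.
  rewrite -mpolyXD submK ?subr0 ?addr0 //; apply/mnm_lepP => j.
  by rewrite mnm1E; case: eqP => // <-; move: im; rewrite inE -lt0n.
exists (fun i => a%:MP * b i + c i); rewrite rmorphD /= -mul_mpolyC rmorphM /= face_substC.
rewrite (_ : _ - _ = a%:MP * ('X_[m] - face_subst W 'X_[m]) + (p - face_subst W p)); last by ring.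
rewrite eb e mulr_sumr -big_split /=; apply: eq_bigr => i _; ring.
Qed.

Lemma face_primeP W f : f \in (face_prime W : pred S) ->
  exists c : 'I_n -> S, f = \sum_(i | i \notin W) c i * 'X_i.
Proof.
rewrite mem_face_prime => /eqP f0; have [c e] := face_subst_diff W f; exists c.
by rewrite -e f0 subr0.
Qed.

Variable D : scomplex n.
Local Notation I := (sr_ideal D : pred S).

Lemma sr_ideal_gen F : F \notin faces D -> \prod_(i in F) 'X_i \in I.
Proof.
move=> FD; apply/asboolP; exists (fun G => if G == F then 1 else 0).
rewrite [RHS](bigD1 F) //= eqxx mul1r [X in _ = _ + X]big1 ?addr0 // => G.
by case/andP => _ /negPf ->; rewrite mul0r.
Qed.

(** The ideal is monomial, and a monomial belongs to it exactly when its support is a nonface. *)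
Lemma mem_sr_ideal f : f \in I <-> (forall m, mnm_supp m \in faces D -> f@_m = 0).
Proof.
split=> [/asboolP [c ->] m mD|h].
  rewrite raddf_sum big1 //= => F FD; apply/eqP; rewrite mcoeff_eq0 prodX_mnm_set.
  apply/negP; rewrite (perm_mem (msuppMX _ _)) => /mapP [m' _ mE].
  case/negP: FD; apply: face_sub mD _; rewrite -mnm_set_le mE; exact: lem_addr.
rewrite (mpolyE f) big_seq rpred_sum // => m; rewrite mcoeff_msupp => fm.
have mD : mnm_supp m \notin faces D by apply: contraNN fm => /h ->.
have -> : m = (m - mnm_set (mnm_supp m) + mnm_set (mnm_supp m))%MM by rewrite submK // mnm_set_le.
rewrite mpolyXD -mul_mpolyC mulrA -prodX_mnm_set.
exact/idealMr/sr_ideal_gen.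
Qed.

Lemma sr_ideal_face F : F \in faces D -> {subset (I : pred S) <= (face_prime F : pred S)}.
Proof.
move=> FD f /asboolP [c ->]; rewrite rpred_sum // => G GD; rewrite idealMr //.
have GE : mnm_supp (mnm_set G) = G by apply/setP => i; rewrite inE mnmE; case: (i \in G).
rewrite mem_face_prime prodX_mnm_set face_substXm GE ifN //.
by apply: contraNN GD; apply: face_sub.
Qed.

End FacePrimes.

(** * Complexes satisfying Serre's condition (S_2) *)

Section SerreConnected.
Variables (K : fieldType) (n : nat) (D : scomplex n).
Local Notation S := {mpoly K[n]}.
Local Notation I := (sr_ideal D : idealr S).

(** Shrinking a face enlarges its prime, so a descending chain of faces above [W] is an ascending
    chain of primes. *)
Lemma dim_ge_faces (W : {set 'I_n}) (k : nat) (V : 'I_k.+1 -> {set 'I_n}) :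
  (forall i, W \subset V i) -> (forall i, V i \in faces D) ->
  (forall i j : 'I_k.+1, (i < j)%N -> V j \proper V i) ->
  dim_ge (A := loc_ring (face_prime K W)) (localization (face_prime K W) (sr_ring K D)) k.
Proof.
move=> WV VD Vlt; apply: (dim_ge_chain (Q := fun i => face_prime K (V i))).
- by move=> i; apply: sr_ideal_face.
- by move=> i; apply: face_prime_sub.
move=> i j /Vlt /properP [sub [x xi xj]]; split; first exact: face_prime_sub.
by exists 'X_x; rewrite mem_face_primeX // negbK.
Qed.

Lemma facetP (F G : {set 'I_n}) : facet D F -> G \in faces D -> F \subset G -> F = G.
Proof. by move=> /maxsetP [_ h] GD FG; apply/esym/h. Qed.

Lemma facet_face (F : {set 'I_n}) : facet D F -> F \in faces D.
Proof. by case/maxsetP. Qed.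

Lemma face_in_facet (F : {set 'I_n}) : F \in faces D -> exists2 G, facet D G & F \subset G.
Proof. by move=> FD; have [G mG FG] := maxset_exists FD; exists G. Qed.

Hypothesis S2 : serre_complex K D 2.

(* Otherwise take [F] in [A] and [G] outside with [W = F :&: G] maximal: the
   link of [W] is disconnected of positive dimension, so localizing at the
   prime of [W] contradicts depth 2. *)
Lemma serre2_adjacent (A : {set {set 'I_n}}) (F0 G0 : {set 'I_n}) :
  facet D F0 -> F0 \in A -> facet D G0 -> G0 \notin A ->
  exists F G, [/\ facet D F, F \in A, facet D G, G \notin A
    & (#|F| = #|F :&: G|.+1) /\ (#|G| = #|F :&: G|.+1)].
Proof.
move=> fF0 F0A fG0 G0A.
pose P (z : {set 'I_n} * {set 'I_n}) :=
  [&& facet D z.1, z.1 \in A, facet D z.2 & z.2 \notin A].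
have P0 : P (F0, G0) by rewrite /P /= fF0 F0A fG0.
case: (arg_maxnP (fun z => #|z.1 :&: z.2|) P0) => [[F G]] /and4P /= [fF FA fG GA] Pmax.
exists F, G; split=> //; apply: contrapT.
have [WF WG] := (subsetIl F G, subsetIr F G).
have WI (X : {set 'I_n}) : (X \subset F :&: G) = (X \subset F) && (X \subset G) by apply: subsetI.
move: (F :&: G) WF WG WI Pmax => W WF WG WI Pmax notadj.
(* By maximality, no set strictly above [W] lies both in a facet of [A] and in a facet outside
   [A]. *)
have maxW (H L X : {set 'I_n}) : facet D H -> H \in A -> facet D L -> L \notin A ->
    W \proper X -> X \subset H -> X \subset L -> False.
  move=> fH HA fL LA WX XH XL; have /= := Pmax (H, L).
  rewrite /P /= fH HA fL LA => /(_ isT) h.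
  have /proper_card : W \proper H :&: L by apply: (proper_sub_trans WX); rewrite subsetI XH.
  by rewrite ltnNge h.
have neFG : F != G by apply: contraNneq GA => <-.
have [i0 i0F i0W] : exists2 i, i \in F & i \notin W.
  apply/subsetPn; apply: contraNN neFG; rewrite WI => /andP [_ FG].
  by apply/eqP/(facetP fF) => //; apply: facet_face.
have [j0 j0G j0W] : exists2 i, i \in G & i \notin W.
  apply/subsetPn; apply: contraNN neFG; rewrite WI => /andP [GF _].
  by apply/eqP/esym/(facetP fG) => //; apply: facet_face.
(* As [F] and [G] are not adjacent, one of them has two vertices outside [W]; removing these one at
   a time gives a chain of length 2. *)
have [H fH [WH cH]] : exists2 H, facet D H & W \subset H /\ (1 < #|H :\: W|)%N.
  have pF : (0 < #|F :\: W|)%N by rewrite card_gt0; apply/set0Pn; exists i0; rewrite inE i0W.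
  have pG : (0 < #|G :\: W|)%N by rewrite card_gt0; apply/set0Pn; exists j0; rewrite inE j0W.
  have [h|h] := ltnP 1 #|F :\: W|; first by exists F.
  have [h'|h'] := ltnP 1 #|G :\: W|; first by exists G.
  have cF : #|F :\: W| = 1%N by apply/eqP; rewrite eqn_leq h.
  have cG : #|G :\: W| = 1%N by apply/eqP; rewrite eqn_leq h'.
  case: notadj; split.
    by rewrite -(cardsID W F) (setIidPr WF) cF addn1.
  by rewrite -(cardsID W G) (setIidPr WG) cG addn1.
have [x [y [xH yH xy]]] := card_gt1P cH.
have dim2 : dim_ge (A := loc_ring (face_prime K W))
    (localization (face_prime K W) (sr_ring K D)) 2.
  move: xH yH; rewrite !inE => /andP [xW xH] /andP [yW yH].
  have HD := facet_face fH.
  apply: (dim_ge_faces (V := fun i : 'I_3 => nth set0 [:: H; H :\ x; H :\ x :\ y] i)).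
  - by case=> [[|[|[|]]]] //= _; rewrite ?subsetD1 ?WH ?xW ?yW.
  - have s2 : H :\ x :\ y \subset H by apply: subset_trans (subsetDl _ _) (subsetDl _ _).
    by case=> [[|[|[|]]]] //= _; apply: (face_sub HD); rewrite ?subsetDl.
  have p1 : H :\ x \proper H by apply: properD1.
  have p2 : H :\ x :\ y \proper H :\ x by apply: properD1; rewrite !inE eq_sym xy.
  case=> [[|[|[|]]]] //= _ [[|[|[|]]]] //= _ _; exact: proper_trans p2 p1.
have /depth_ge_loc := S2 (leqnn 2) dim2.
case=> t [sz tp reg _]; case: t sz tp reg => [|a [|b [|? ?]]] // _ tp reg.
set p := face_prime K W in tp reg.
have [ca aE] := face_primeP (tp a (mem_head _ _)).
have bp : b \in (p : pred S) by apply: tp; rewrite !inE eqxx orbT.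
have [cb bE] := face_primeP bp.
(* [U] is one side of the disconnected link: the vertices that extend [W] inside a facet of [A]. The
   other side is everything outside [W] and [U]. *)
pose U := [set i | (i \notin W) && [exists L : {set 'I_n}, [&& facet D L, L \in A & i |: W \subset L]]].
have inU i : i \in U -> i \notin W /\ exists L, [/\ facet D L, L \in A & i |: W \subset L].
  by rewrite inE => /andP [iW /existsP [L /and3P [? ? ?]]]; split=> //; exists L.
have pW i : i \notin W -> W \proper i |: W by move=> iW; apply/properUr; rewrite sub1set.
have i0U : i0 \in U.
  by rewrite inE i0W; apply/existsP; exists F; rewrite fF FA subUset sub1set i0F.
have j0U : j0 \notin U.
  apply/negP => /inU [_ [L [fL LA h]]].
  by apply: (maxW L G (j0 |: W)) => //; [exact: pW|rewrite subUset sub1set j0G].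
pose u : S := \prod_(i in W) 'X_i.
have up : u \notin (p : pred S).
  rewrite mem_face_prime rmorph_prod; apply/prodf_neq0 => i iW /=.
  by rewrite -mem_face_prime mem_face_primeX negbK.
(* The factor [u] is a unit at [p] and completes [i], [j] to a nonface, so variables from opposite
   sides multiply to 0 locally. *)
have uIJ i j : i \in U -> j \notin W -> j \notin U -> u * ('X_i * 'X_j) \in (I : pred S).
  move=> iU jW jU; have [iW [L [fL LA iL]]] := inU i iU.
  have ij : i != j by apply: contraTneq iU => ->.
  have -> : u * ('X_i * 'X_j) = \prod_(k in i |: (j |: W)) 'X_k.
    by rewrite !big_setU1 /=; [rewrite /u; ring|exact: jW|rewrite !inE negb_or ij].
  apply: sr_ideal_gen; apply/negP => /face_in_facet [M fM sM].
  have [iM jM] : i |: W \subset M /\ j |: W \subset M.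
    by split; apply: subset_trans sM; rewrite ?subsetUr // setUS // subsetUr.
  have [MA|MA] := boolP (M \in A); last exact: (maxW L M _ fL LA fM MA (pW i iW)).
  by move/negP: jU; apply; rewrite inE jW; apply/existsP; exists M; rewrite fM MA.
pose sU (c : 'I_n -> S) := \sum_(i in U) c i * 'X_i.
pose sV (c : 'I_n -> S) := \sum_(i | (i \notin W) && (i \notin U)) c i * 'X_i.
have split_sum c : \sum_(i | i \notin W) c i * 'X_i = sU c + sV c.
  rewrite (bigID (mem U)) /=; congr (_ + _); apply: eq_bigl => i.
  by rewrite andbC; case: (boolP (i \in U)) => //= /inU [->].
have uUV c e : u * (sU c * sV e) \in (I : pred S).
  rewrite mulr_suml mulr_sumr rpred_sum // => i iU; rewrite !mulr_sumr rpred_sum // => j /andP [jW jU].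
  rewrite (_ : _ * _ = c i * e j * (u * ('X_i * 'X_j))); last by ring.
  by apply: idealMr; apply: uIJ.
have sUX j c : j \notin W -> j \notin U -> u * (sU c * 'X_j) \in (I : pred S).
  move=> jW jU; have := uUV c (fun k => if k == j then 1 else 0).
  rewrite /sV (bigD1 j) ?jW //= eqxx mul1r big1 ?addr0 // => k /andP [_ /negPf ->].
  by rewrite mul0r.
have sVX i c : i \in U -> u * (sV c * 'X_i) \in (I : pred S).
  move=> iU; have := uUV (fun k => if k == i then 1 else 0) c.
  rewrite /sU (bigD1 i) //= eqxx mul1r big1 => [|k /andP [_ /negPf ->]]; last by rewrite mul0r.
  by rewrite addr0 [_ * sV c]mulrC.
rewrite split_sum in aE; rewrite split_sum in bE.
have reg0 z : in_gen p I [::] (a * z) -> in_gen p I [::] z by apply: (reg 0%N).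
have reg1 z : in_gen p I [:: a] (b * z) -> in_gen p I [:: a] z by apply: (reg 1%N).
(* Write a = aU + aV and b = bU + bV. Cross products vanish, so b aU = bU aU = bU a locally, and
   regularity of [b] modulo [a] puts aU into the ideal of [a]: v aU = c a. *)
have [v vp [c [w wp hc]]] : in_gen p I [:: a] (sU ca).
  apply: reg1; exists 1; rewrite ?idealr1 //; exists (sU cb), u => //.
  rewrite (_ : _ * _ = u * (sU ca * sV cb) - u * (sU cb * sV ca)); last by rewrite aE bE; ring.
  exact: rpredB.
(* After cancelling [a], the relation lies in the prime of the face [k |: W], which does not contain
   ['X_k]. *)
have kill k z : k \notin W -> k |: W \in faces D -> in_gen p I [::] (a * (z * 'X_k)) -> z \in (p : pred S).
  move=> kW kD /reg0 [r rp h].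
  have := sr_ideal_face kD h; rewrite !prime_idealrM mem_face_primeX inE in_set1 eqxx orbF.
  have sub : {subset (face_prime K (k |: W) : pred S) <= (p : pred S)}.
    by apply: face_prime_sub; apply: subsetUr.
  case/orP=> [/sub rp'|/sub zp']; first by rewrite rp' in rp.
  exact: zp'.
have wu : w * u \notin (p : pred S) by rewrite prime_idealrM negb_or wp.
(* Multiplying v aU = c a by X_j0 kills the left side and forces [c] into [p]; multiplying by X_i0
   turns [a] into aU and forces [v - c] into [p]. Together they contradict the choice of the
   denominator [v]. *)
have cp : c \in (p : pred S).
  apply: (kill j0) => //; first by apply: face_sub (facet_face fG) _; rewrite subUset sub1set j0G.
  exists (w * u) => //.
  rewrite (_ : _ * _ = w * v * (u * (sU ca * 'X_j0)) - u * 'X_j0 * (w * (v * sU ca - a * c))); last by ring.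
  by rewrite rpredB // idealMr // sUX.
have vcp : v - c \in (p : pred S).
  apply: (kill i0) => //; first by apply: face_sub (facet_face fF) _; rewrite subUset sub1set i0F.
  exists (w * u) => //.
  rewrite (_ : _ * _ = w * v * (u * (sV ca * 'X_i0)) + u * 'X_i0 * (w * (v * sU ca - a * c))); last by rewrite aE; ring.
  by rewrite rpredD // idealMr // sVX.
by case/negP: vp; rewrite -(subrK c v) rpredD.
Qed.
End SerreConnected.

Section CommonVertex.
Variables (K : fieldType) (n : nat) (D : scomplex n).
Hypothesis S2 : serre_complex K D 2.

Definition facets : {set {set 'I_n}} := [set F | facet D F].

Lemma rank_facet : exists2 F, facet D F & #|F| = rank D.
Proof.
have [F FD cF] : exists2 F, F \in faces D & #|F| = rank D.
  have [|F FD cF] := eq_bigmax_cond (fun F : {set 'I_n} => #|F|) (A := mem (faces D)).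
    by apply/card_gt0P; exists set0; apply: face_empty.
  by exists F.
have [G fG FG] := face_in_facet FD; exists G => //; apply/eqP.
rewrite eqn_leq -{2}cF subset_leq_card // andbT.
by apply: (bigmax_sup G) => //; apply: facet_face.
Qed.

(* Adding the facets one by one along adjacencies, the intersection loses at
   most one vertex at each step. *)
Lemma serre2_grow (k : nat) : (0 < k <= #|facets|)%N ->
  exists A : {set {set 'I_n}}, [/\ A \subset facets, #|A| = k,
    forall F, F \in A -> #|F| = rank D & (rank D < #|\bigcap_(F in A) F| + k)%N].
Proof.
elim: k => // -[|k] IH /= kle.
  have [F fF cF] := rank_facet; exists [set F]; split.
  - by rewrite sub1set inE.
  - by rewrite cards1.
  - by move=> G /set1P ->.
  - by rewrite big_set1 cF addn1.
have [A [sA cA rA iA]] := IH (ltnW kle).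
have /set0Pn [F0 F0A] : A != set0 by rewrite -card_gt0 cA.
have [G0 fG0 G0A] : exists2 G, G \in facets & G \notin A.
  by apply/subsetPn; apply: contraTN kle => /subset_leq_card; rewrite cA -ltnNge.
have fF0 : facet D F0 by move/subsetP/(_ _ F0A): sA; rewrite inE.
rewrite inE in fG0.
have [F [G [fF FA fG GA [cF cG]]]] := serre2_adjacent S2 fF0 F0A fG0 G0A.
exists (G |: A); split.
- by rewrite subUset sub1set inE fG.
- by rewrite cardsU1 GA cA.
- by move=> H /setU1P [->|/rA //]; rewrite cG -cF rA.
rewrite big_setU1 //= setIC; apply: leq_trans iA _.
have c1 : #|F :\: G| = 1%N by apply: (@addnI #|F :&: G|); rewrite cardsID cF addn1.
set B := \bigcap_(F in A) F; rewrite -[#|B|](cardsID G) -addnA leq_add2l -[k.+2]add1n leq_add2r -c1.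
exact/subset_leq_card/setSD/bigcap_inf.
Qed.

Lemma serre2_facets_meet : (forall F, facet D F -> #|F| = rank D) /\
  (rank D < #|\bigcap_(F in facets) F| + #|facets|)%N.
Proof.
have pos : (0 < #|facets|)%N.
  by have [F fF _] := rank_facet; apply/card_gt0P; exists F; rewrite inE.
have [|A [sA cA rA iA]] := @serre2_grow #|facets|; first by rewrite pos /=.
have AE : A = facets by apply/eqP; rewrite eqEcard sA cA /=.
by rewrite AE in rA iA; split=> // F fF; apply: rA; rewrite inE.
Qed.

(** The hypothesis counts faces of maximal size because that is the number given by h(1). *)
Lemma serre2_common_vertex : (#|[set F in faces D | #|F| == rank D]| <= rank D)%N ->
  exists v, forall F, facet D F -> v \in F.
Proof.
have [pureD meet] := serre2_facets_meet.
have sub : facets \subset [set F in faces D | #|F| == rank D].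
  by apply/subsetP => F; rewrite !inE => fF; rewrite facet_face // pureD /=.
move=> le; have fle := leq_trans (subset_leq_card sub) le.
have /card_gt0P [v vA] : (0 < #|\bigcap_(F in facets) F|)%N.
  by rewrite lt0n; apply: contraTneq meet => ->; rewrite add0n -leqNgt.
by exists v => F fF; move/bigcapP: vA; apply; rewrite inE.
Qed.

End CommonVertex.

(** * Hilbert functions and h-vectors *)

Lemma row_kernel (K : fieldType) (k l : nat) (A : 'M[K]_(k, l)) : (l < k)%N ->
  exists2 u : 'rV_k, u != 0 & u *m A = 0.
Proof.
move=> lk; exists (nz_row (kermx A)); last by apply/sub_kermxP/nz_row_sub.
by rewrite nz_row_eq0 -mxrank_eq0 mxrank_ker subn_eq0 -ltnNge (leq_ltn_trans (rank_leq_col A)).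
Qed.

Section HilbertFunction.
Variables (K : fieldType) (n : nat) (D : scomplex n).
Local Notation S := {mpoly K[n]}.
Local Notation I := (sr_ideal D : idealr S).

Definition supp_ffun (M : nat) (e : {ffun 'I_n -> 'I_M}) : {set 'I_n} :=
  [set j | e j != 0%N :> nat].

(** Bounding exponents by [M] makes the type finite; nothing is lost in degrees below [M]. *)
Definition face_exps (M i : nat) : {set {ffun 'I_n -> 'I_M}} :=
  [set e : {ffun 'I_n -> 'I_M} | ((\sum_j e j)%N == i) && (supp_ffun e \in faces D)].

Definition mnm_of (M : nat) (e : {ffun 'I_n -> 'I_M}) : 'X_{1..n} :=
  [multinom (e j : nat) | j < n].

Lemma mnm_of_inj (M : nat) : injective (@mnm_of M).
Proof.
by move=> e f /mnmP ef; apply/ffunP => j; apply: val_inj; have := ef j; rewrite !mnmE.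
Qed.

Lemma mnm_supp_of (M : nat) (e : {ffun 'I_n -> 'I_M}) : mnm_supp (mnm_of e) = supp_ffun e.
Proof. by apply/setP => j; rewrite !inE mnmE. Qed.

Lemma mdeg_mnm_of (M : nat) (e : {ffun 'I_n -> 'I_M}) : mdeg (mnm_of e) = (\sum_j e j)%N.
Proof. by rewrite mdegE; apply: eq_bigr => j _; rewrite mnmE. Qed.

Lemma mnm_of_surj (M : nat) (m : 'X_{1..n}) : (mdeg m < M)%N ->
  exists e : {ffun 'I_n -> 'I_M}, m = mnm_of e.
Proof.
case: M => // M mM; exists [ffun j => inord (m j)]; apply/mnmP => j.
rewrite mnmE ffunE inordK //; apply: leq_ltn_trans mM.
by rewrite mdegE (bigD1 j) //= leq_addr.
Qed.

Lemma cyclic_pi_lin (k : nat) (c : 'I_k -> K) (f : 'I_k -> S) :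
  \sum_j (c j)%:MP *: cyclic_pi I (f j) = cyclic_pi I (\sum_j (c j)%:MP * f j).
Proof.
rewrite [RHS](raddf_sum (quot_pi I)); apply: eq_bigr => j _.
exact: cyclic_piZ.
Qed.

(** The monomials supported on faces form a basis of the Stanley-Reisner ring. *)
Lemma hilbert_function_exps (M i : nat) : (i < M)%N ->
  hilbert_function_is K D i #|face_exps M i|.
Proof.
move=> iM; pose mon (j : 'I_#|face_exps M i|) := mnm_of (enum_val j).
have monP j : mdeg (mon j) = i /\ mnm_supp (mon j) \in faces D.
  have := enum_valP j; rewrite inE => /andP [/eqP e1 e2].
  by rewrite mdeg_mnm_of mnm_supp_of.
have mon_inj j k : (mon j == mon k) = (j == k).
  by rewrite (inj_eq (@mnm_of_inj M)) (inj_eq enum_val_inj).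
have coef_mon (c : 'I_#|face_exps M i| -> K) j : (\sum_k (c k)%:MP * 'X_[mon k])@_(mon j) = c j.
  rewrite raddf_sum (bigD1 j) //= mul_mpolyC mcoeffZ mcoeffX eqxx mulr1 big1 ?addr0 // => k kj.
  by rewrite mul_mpolyC mcoeffZ mcoeffX mon_inj (negPf kj) mulr0.
exists (fun j => cyclic_pi I 'X_[mon j]); split.
- move=> j; exists 'X_[mon j] => //; rewrite dhomogX; exact/eqP/(monP j).1.
- move=> c; rewrite cyclic_pi_lin => /cyclic_pi_eq0 /mem_sr_ideal h j.
  by rewrite -(coef_mon c) h // (monP j).2.
move=> x [f fh ->]; exists (fun j => f@_(mon j)); rewrite cyclic_pi_lin.
apply/eqP; rewrite -subr_eq0 -cyclic_piB; apply/eqP/cyclic_pi_eq0/mem_sr_ideal => m mD.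
have [mi|mi] := eqVneq (mdeg m) i; last first.
  rewrite mcoeffB (dhomog_nemf_coeff fh mi) sub0r raddf_sum big1 ?oppr0 //= => j _.
  rewrite mul_mpolyC mcoeffZ mcoeffX; case: eqP => [e|]; last by rewrite mulr0.
  by rewrite -e (monP j).1 eqxx in mi.
have [e mE] : exists e : {ffun 'I_n -> 'I_M}, m = mnm_of e by apply: mnm_of_surj; rewrite mi.
have eF : e \in face_exps M i by rewrite inE -mdeg_mnm_of -mnm_supp_of -mE mi eqxx.
have -> : m = mon (enum_rank_in eF e) by rewrite /mon enum_rankK_in.
by rewrite mcoeffB coef_mon subrr.
Qed.

(** Otherwise the coordinate matrix of one basis in the other has more rows than columns, and a
    dependence among its rows contradicts freeness. *)
Lemma hilbert_function_le (i k l : nat) :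
  hilbert_function_is K D i k -> hilbert_function_is K D i l -> (k <= l)%N.
Proof.
move=> [b [bg bfree _]] [b' [_ _ bspan]]; rewrite leqNgt; apply/negP => lk.
have [A bA] := choice (fun j => bspan _ (bg j)).
have [u u0 uA] := row_kernel (\matrix_(j, r) A j r) lk.
case/negP: u0; apply/eqP/rowP => j; rewrite mxE; apply: (bfree (u 0)).
under eq_bigr => q _ do rewrite bA scaler_sumr.
rewrite exchange_big big1 //= => r _.
transitivity (((u *m (\matrix_(j, r) A j r)) 0 r)%:MP *: b' r); last by rewrite uA mxE scale0r.
rewrite mxE rmorph_sum scaler_suml; apply: eq_bigr => q _.
by rewrite mxE rmorphM scalerA.
Qed.

Lemma hilbert_function_uniq (i k l : nat) :
  hilbert_function_is K D i k -> hilbert_function_is K D i l -> k = l.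
Proof. by move=> hk hl; apply/eqP; rewrite eqn_leq !(hilbert_function_le (i := i)). Qed.

End HilbertFunction.

Section HPolynomial.
Variables (n : nat) (D : scomplex n).

(** The sum of t^|F| / (1 - t)^|F| over the faces, multiplied by (1 - t)^d. *)
Definition hpoly : {poly int} :=
  \sum_(F in faces D) 'X ^+ #|F| * (1 - 'X) ^+ (rank D - #|F|).

(* Truncating the geometric series keeps generating functions polynomial; only
   coefficients below [M] are meaningful. *)
Definition face_series (M : nat) : {poly int} :=
  \sum_(F in faces D) (\sum_(1 <= k < M) 'X^k) ^+ #|F|.

Lemma face_le_rank (F : {set 'I_n}) : F \in faces D -> (#|F| <= rank D)%N.
Proof. by move=> FD; apply: (bigmax_sup F). Qed.

Lemma coef_face_series (M l : nat) : (l < M)%N ->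
  (face_series M)`_l = #|face_exps D M l|%:Z.
Proof.
case: M => // M lM; rewrite /face_series.
(* Expanding the product chooses a positive exponent for each vertex of [F] and exponent 0
   elsewhere. *)
have FE (F : {set 'I_n}) : (\sum_(1 <= k < M.+1) 'X^k) ^+ #|F| =
    \sum_(e : {ffun 'I_n -> 'I_M.+1} | supp_ffun e == F) 'X^(\sum_j e j) :> {poly int}.
  rewrite -prodr_const big_mkcond /=.
  transitivity (\prod_j \sum_(k < M.+1 | ((k : nat) != 0%N) == (j \in F)) 'X^k : {poly int}).
    apply: eq_bigr => j _; case: (j \in F).
      rewrite big_add1 big_mkord /= [RHS]big_mkcond [RHS]big_ord_recl /= add0r.
      by apply: eq_bigr.
    by rewrite (big_pred1 ord0) ?expr0 // => k; rewrite eqbF_neg negbK.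
  rewrite bigA_distr_big_dep; apply: eq_big => [e|e _]; last by rewrite expr_sum.
  apply/familyP/eqP => [h|<- j]; last by rewrite unfold_in inE.
  by apply/setP => j; rewrite inE; have := h j; rewrite unfold_in => /eqP.
transitivity ((\sum_(e : {ffun 'I_n -> 'I_M.+1} | supp_ffun e \in faces D)
    'X^(\sum_j e j) : {poly int})`_l).
  congr (nth 0 (polyseq _) l); rewrite [RHS](partition_big (@supp_ffun n M.+1) (fun F => F \in faces D)) //=.
  apply: eq_bigr => F FD; rewrite FE; apply: eq_bigl => e.
  by case: eqP => [->|]; rewrite ?FD ?andbF.
rewrite coef_sum -sum1_card rmorph_sum /= big_mkcond [RHS]big_mkcond /=.
apply: eq_bigr => e _; rewrite inE coefXn eq_sym andbC.
by case: (supp_ffun e \in _); case: eqP.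
Qed.

Lemma face_series_hpoly (M l : nat) : (l < M)%N ->
  ((1 - 'X) ^+ rank D * face_series M)`_l = hpoly`_l.
Proof.
case: M => // M lM.
have geom : (1 - 'X) * (\sum_(1 <= k < M.+1) 'X^k) = 'X - 'X^(M.+1) :> {poly int}.
  rewrite mulrBl mul1r mulr_sumr.
  under [X in _ - X]eq_bigr do rewrite -exprS.
  rewrite -sumrB -(opprK (\sum_(_ <= _ < _) _)) -sumrN.
  under eq_bigr do rewrite opprB.
  by rewrite (telescope_sumr (fun k => 'X^k)) // opprB expr1.
(* The truncation error is a multiple of X^(M+1) and does not reach coefficient [l]. *)
have powE (k : nat) : exists q : {poly int}, ('X - 'X^(M.+1)) ^+ k = 'X^k + 'X^(M.+1) * q.
  move: ('X^(M.+1)) => N; elim: k => [|k [q e]]; first by exists 0; rewrite !expr0 mulr0 addr0.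
  by exists ('X * q - ('X^k + N * q)); rewrite !exprS e; ring.
rewrite /face_series /hpoly mulr_sumr !coef_sum; apply: eq_bigr => F FD.
rewrite -[in LHS](subnK (face_le_rank FD)) exprD -mulrA -exprMn geom.
have [q ->] := powE #|F|.
by rewrite mulrDr coefD [_ * 'X^#|F|]mulrC mulrCA [('X^(M.+1) * _)`_l]coefXnM lM addr0.
Qed.

Variable K : fieldType.

(** The Hilbert function counts monomials, so the field disappears from the condition. *)
Lemma is_h_vectorP (h : seq int) : is_h_vector K D h <->
  size h = (rank D).+1 /\ forall i, h`_i = hpoly`_i.
Proof.
have conv (H : nat -> nat) (i : nat) : (forall l, hilbert_function_is K D l (H l)) ->
    \sum_(j < i.+1) ((1 - 'X : {poly int}) ^+ rank D)`_j * (H (i - j)%N)%:Z = hpoly`_i.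
  move=> HH; rewrite -(face_series_hpoly (leqnn i.+1)) coefM; apply: eq_bigr => j _.
  have lt : (i - j < i.+1)%N by rewrite ltnS leq_subr.
  rewrite coef_face_series //.
  by rewrite (hilbert_function_uniq (HH _) (hilbert_function_exps K D lt)).
split=> [[sz [H [HH hE]]]|[sz hE]]; split=> //; first by move=> i; rewrite -hE conv.
exists (fun i => #|face_exps D i.+1 i|).
have HH l : hilbert_function_is K D l #|face_exps D l.+1 l| by apply: hilbert_function_exps.
by split=> // i; rewrite (conv (fun i => #|face_exps D i.+1 i|)).
Qed.

Lemma hpoly1 : hpoly.[1] = #|[set F in faces D | #|F| == rank D]|%:Z.
Proof.
rewrite /hpoly horner_sum -sum1_card rmorph_sum /= [LHS]big_mkcond [RHS]big_mkcond /=.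
apply: eq_bigr => F _; rewrite inE; case: ifP => //= FD.
rewrite hornerM !horner_exp hornerD hornerN !hornerX hornerC subrr expr1n mul1r expr0n.
by rewrite subn_eq0 eqn_leq face_le_rank //=; case: ifP.
Qed.

(** Pairing a face [F] without [v] with [v |: F] gives t^|F| (1 - t)^(d - |F| - 1), of degree only d
    - 1. *)
Lemma hpoly_cone (v : 'I_n) : (forall F, facet D F -> v \in F) -> hpoly`_(rank D) = 0.
Proof.
move=> cone.
have addv (F : {set 'I_n}) : F \in faces D -> v |: F \in faces D.
  move=> FD; have [G fG FG] := face_in_facet FD; apply: (face_sub (facet_face fG)).
  by rewrite subUset sub1set cone.
rewrite /hpoly (bigID (fun F : {set 'I_n} => v \in F)) /=.
rewrite (reindex_onto (fun F => v |: F) (fun F => F :\ v)) /=; last first.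
  by move=> F /andP [_ vF]; rewrite setD1K.
rewrite (eq_bigl (fun F => (F \in faces D) && (v \notin F))) => [|F]; last first.
  rewrite setU11 andbT; case: (boolP (v \in F)) => vF.
    rewrite andbF; apply/negbTE; apply: contraTN vF => /andP [_ /eqP <-].
    by rewrite !inE eqxx.
  rewrite setU1K // eqxx !andbT; apply/idP/idP => [h|]; last exact: addv.
  by apply: face_sub h _; apply: subsetUr.
rewrite -big_split /= coef_sum big1 // => F /andP [FD vF].
have lt : (#|F| < rank D)%N by have := face_le_rank (addv F FD); rewrite cardsU1 vF.
rewrite cardsU1 vF add1n (_ : _ + _ = 'X^#|F| * (1 - 'X) ^+ (rank D - #|F|.+1)).
  rewrite coefXnM ltnNge ltnW //= nth_default //.
  apply: leq_trans (size_poly_exp_leq _ _) _.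
  have -> : size (1 - 'X : {poly int}) = 2%N by rewrite -opprB size_polyN size_XsubC.
  by rewrite mul1n -subSn // subSS.
rewrite -(subnSK lt) !exprS; move: ('X^#|F|) ((1 - 'X) ^+ _) => x y; ring.
Qed.

End HPolynomial.

(** * Two complexes *)

Section FaceSums.
Variable n : nat.

Definition face_weight (F : {set 'I_n}) : {poly int} := \prod_i (if i \in F then 'X else 1 - 'X).

(** Each vertex outside [A] and [B] is free and contributes t + (1 - t) = 1. *)
Lemma sum_face_weight (A B : {set 'I_n}) : [disjoint A & B] ->
  \sum_(F : {set 'I_n}) ((A \subset F) && [disjoint B & F])%:R * face_weight F
    = 'X ^+ #|A| * (1 - 'X) ^+ #|B|.
Proof.
move=> AB; pose f i : {poly int} := if i \in B then 0 else 'X.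
pose g i : {poly int} := if i \in A then 0 else 1 - 'X.
transitivity (\prod_i (f i + g i)).
  rewrite (bigA_distr _ _ f g); apply: eq_bigr => F _; rewrite /face_weight.
  have [/andP [/subsetP AF BF]|nF] := boolP (_ && _).
    rewrite mul1r; apply: eq_bigr => i _; rewrite /f /g; case: ifPn => iF.
      by rewrite (disjointFl BF iF).
    by case: ifP => // /AF; rewrite (negPf iF).
  rewrite mul0r; move: nF; rewrite negb_and => /orP [/subsetPn [i iA iF]|].
    by rewrite (bigD1 i) //= (negPf iF) /g iA mul0r.
  rewrite -setI_eq0 => /set0Pn [i /setIP [iB iF]].
  by rewrite (bigD1 i) //= iF /f iB mul0r.
rewrite -!prodr_const (big_mkcond (mem A)) (big_mkcond (mem B)) -big_split /=.
apply: eq_bigr => i _; rewrite /f /g; have := disjointFr AB (x := i).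
by case: (i \in A) => [->|_] //; case: (i \in B); rewrite ?addr0 ?add0r ?mulr1 ?mul1r // addrC subrK.
Qed.

(** The extra power of 1 - t replaces the rank by [n] in the exponents, so that all sets are
    weighted uniformly and inclusion-exclusion applies. *)
Lemma hpolyM (D : scomplex n) :
  (1 - 'X) ^+ (n - rank D) * hpoly D = \sum_(F : {set 'I_n}) (F \in faces D)%:R * face_weight F.
Proof.
have rn : (rank D <= n)%N.
  by apply/bigmax_leqP => F _; rewrite -[n in (_ <= n)%N](card_ord n) max_card.
rewrite /hpoly mulr_sumr [LHS]big_mkcond; apply: eq_bigr => F _.
case: (boolP (F \in faces D)) => [FD|_]; last by rewrite mul0r.
rewrite mul1r mulrCA -exprD addnBA ?face_le_rank // subnK //.
have -> : (n - #|F|)%N = #|~: F| by rewrite [RHS]cardsCs setCK card_ord.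
rewrite -!prodr_const (big_mkcond (mem F)) (big_mkcond (mem (~: F))) -big_split /=.
by apply: eq_bigr => i _; rewrite !inE; case: (i \in F); rewrite ?mulr1 ?mul1r.
Qed.

End FaceSums.

Section PureExample.
Variable d : nat.
Hypothesis d5 : (5 <= d)%N.
Local Notation V := 'I_d.+2.

Let a : V := inord 0.
Let a' : V := inord 1.
Let b : V := inord 2.
Let L : {set V} := [set i : V | (2 < i)%N].

(* The facets are the complements of the edges of the graph on [d + 2]
   vertices made of the edge [a a'] and of the star with centre [b] and
   [d - 1] leaves [L]. *)
Definition star_faces : {set {set V}} :=
  [set F : {set V} | ((a \notin F) && (a' \notin F)) || ((b \notin F) && ~~ (L \subset F))].

Let aE : a = 0%N :> nat. Proof. by rewrite inordK. Qed.
Let a'E : a' = 1%N :> nat. Proof. by rewrite inordK. Qed.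
Let bE : b = 2%N :> nat. Proof. by rewrite inordK //; lia. Qed.

Lemma star_empty : set0 \in star_faces.
Proof. by rewrite !inE. Qed.

Lemma star_vertex (i : V) : [set i] \in star_faces.
Proof.
rewrite !inE -!val_eqE /= aE a'E bE.
have [i1|i1] := leqP i 1; last by apply/orP; left; lia.
apply/orP; right; apply/andP; split; first lia.
apply/subsetPn; exists ord_max; first by rewrite inE /=; lia.
by rewrite inE -val_eqE /=; lia.
Qed.

Lemma star_sub (F G : {set V}) : F \in star_faces -> G \subset F -> G \in star_faces.
Proof.
rewrite !inE => FD GF; have sub i : i \notin F -> i \notin G by apply/contraNN; apply: (subsetP GF).
case/orP: FD => /andP [h1 h2]; first by rewrite (sub a) // (sub a').
apply/orP; right; rewrite (sub b) //=; apply: contraNN h2 => LG.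
exact: subset_trans LG GF.
Qed.

Definition star_complex : scomplex d.+2 := SComplex star_empty star_vertex star_sub.

Lemma star_face_extend (F : {set V}) : F \in star_faces ->
  exists G : {set V}, [/\ G \in star_faces, F \subset G & #|G| = d].
Proof.
have card2 (i j : V) : i != j -> #|~: [set i; j]| = d.
  by move=> ij; rewrite cardsCs setCK cards2 ij card_ord subn2.
rewrite inE => /orP [/andP [aF a'F]|/andP [bF /subsetPn [l lL lF]]].
  exists (~: [set a; a']); split; first by rewrite !inE !eqxx orbT.
    by rewrite subsets_disjoint setCK disjoint_sym disjoints_subset subUset !sub1set !inE aF.
  by apply: card2; rewrite -val_eqE /= aE a'E.
exists (~: [set b; l]); split.
- rewrite !inE eqxx /=; apply/orP; right; apply/subsetPn; exists l => //.
  by rewrite !inE eqxx orbT.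
- by rewrite subsets_disjoint setCK disjoint_sym disjoints_subset subUset !sub1set !inE bF.
by apply: card2; move: lL; rewrite -val_eqE /= inE bE; lia.
Qed.

Lemma star_facet_card (F : {set V}) : facet star_complex F -> #|F| = d.
Proof.
move=> fF; have [G [GD FG cG]] := star_face_extend (facet_face fF).
by rewrite (facetP fF GD FG).
Qed.

Lemma star_pure : pure star_complex.
Proof. by move=> F G /star_facet_card -> /star_facet_card ->. Qed.

Lemma star_rank : rank star_complex = d.
Proof. by have [F /star_facet_card cF rF] := rank_facet star_complex; rewrite -rF. Qed.

Lemma star_hpoly : hpoly star_complex = 'X - 2 *: 'X^d + \sum_(i < d.+1) 'X^i.
Proof.
have u0 : (1 - 'X : {poly int}) != 0 by rewrite -opprB oppr_eq0 polyXsubC_eq0.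
apply: (mulfI (expf_neq0 2 u0)).
have e2 : (d.+2 - d)%N = 2%N by lia.
have := hpolyM star_complex; rewrite star_rank e2 => ->.
(* Inclusion-exclusion over the two kinds of facets and the condition [L \subset F]; every term is
   the indicator of an interval of sets. *)
have ind (F : {set V}) : (F \in faces star_complex)%:R =
    ((set0 \subset F) && [disjoint [set a; a'] & F])%:R
    + ((set0 \subset F) && [disjoint [set b] & F])%:R
    - ((L \subset F) && [disjoint [set b] & F])%:R
    - ((set0 \subset F) && [disjoint a |: [set a'; b] & F])%:R
    + ((L \subset F) && [disjoint a |: [set a'; b] & F])%:R :> {poly int}.
  rewrite sub0set !disjoints_subset !subUset !sub1set !inE /=.
  by case: (a \in F); case: (a' \in F); case: (b \in F); case: (L \subset F) => /=; ring.
under eq_bigr => F _ do rewrite ind !(mulrDl, mulNr).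
rewrite !big_split /= !sumrN.
have [ab a'b aa'] : [/\ a != b, a' != b & a != a'] by rewrite -!val_eqE /= aE a'E bE.
have LC : ~: L = a |: [set a'; b].
  by apply/setP => i; rewrite !inE -!val_eqE /= aE a'E bE; lia.
have cB : #|a |: [set a'; b]| = 3%N by rewrite cardsU1 !inE negb_or aa' ab cards2 a'b.
have cL : #|L| = d.-1 by rewrite cardsCs LC cB card_ord; lia.
rewrite !sum_face_weight ?disjoint_sets0 ?disjoints_subset ?sub0set ?LC ?setCK //; last first.
  by apply/subsetP => i; rewrite !inE -val_eqE /= bE; lia.
  by rewrite -LC setCK.
rewrite cards0 cL cards2 aa' cards1 cB.
have dE : d = d.-1.+1 by lia.
have geom : (1 - 'X) * (\sum_(i < d.+1) 'X^i) = 1 - 'X * ('X * 'X^(d.-1)) :> {poly int}.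
  by rewrite -exprS -dE -exprS -[RHS]opprB subrX1 -mulNr opprB.
rewrite [RHS]mulrDr [X in _ = _ + X](_ : _ = (1 - 'X) * (1 - 'X * ('X * 'X^(d.-1)))); last first.
  by rewrite -geom mulrA expr2.
have -> : 2 *: 'X^d = 2%:R * ('X * 'X^(d.-1)) :> {poly int}.
  by rewrite -exprS -dE -mul_polyC polyC_natr.
by move: ('X^(d.-1)) => y; ring.
Qed.

End PureExample.

Section Square.

Definition sq0 : 'I_4 := @Ordinal 4 0 isT.
Definition sq1 : 'I_4 := @Ordinal 4 1 isT.
Definition sq2 : 'I_4 := @Ordinal 4 2 isT.
Definition sq3 : 'I_4 := @Ordinal 4 3 isT.

Definition square_faces : {set {set 'I_4}} :=
  [set F : {set 'I_4} | ~~ ([set sq0; sq2] \subset F) && ~~ ([set sq1; sq3] \subset F)].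

Lemma mem_square (F : {set 'I_4}) : (F \in square_faces) =
  ~~ ((sq0 \in F) && (sq2 \in F)) && ~~ ((sq1 \in F) && (sq3 \in F)).
Proof. by rewrite inE !subUset !sub1set. Qed.

Lemma square_empty : set0 \in square_faces.
Proof. by rewrite mem_square !inE. Qed.

Lemma square_vertex (i : 'I_4) : [set i] \in square_faces.
Proof. by rewrite mem_square !inE -!val_eqE; case: i => [[|[|[|[|]]]]]. Qed.

Lemma square_sub (F G : {set 'I_4}) : F \in square_faces -> G \subset F -> G \in square_faces.
Proof.
rewrite !inE => /andP [h1 h2] GF; apply/andP; split; [apply: contraNN h1|apply: contraNN h2];
  by move=> h; apply: subset_trans h GF.
Qed.

Definition square : scomplex 4 := SComplex square_empty square_vertex square_sub.

Lemma card_I4 (F : {set 'I_4}) :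
  #|F| = ((sq0 \in F) + (sq1 \in F) + (sq2 \in F) + (sq3 \in F))%N.
Proof.
rewrite -sum1_card big_mkcond /= !big_ord_recl big_ord0 addn0 !addnA.
by congr (_ + _ + _ + _)%N; rewrite -[RHS]/(if _ then _ else _);
  congr (if _ \in F then _ else _); apply: val_inj.
Qed.

Lemma square_rank : rank square = 2%N.
Proof.
apply/eqP; rewrite eqn_leq; apply/andP; split.
  apply/bigmax_leqP => F; rewrite [_ \in _]mem_square card_I4.
  by case: (sq0 \in F); case: (sq1 \in F); case: (sq2 \in F); case: (sq3 \in F).
apply: (bigmax_sup [set sq0; sq1]); last by rewrite cards2.
by rewrite [_ \in _]mem_square !inE.
Qed.

Lemma square_hpoly : hpoly square = 1 + 2%:R * 'X + 'X ^+ 2.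
Proof.
have u0 : (1 - 'X : {poly int}) != 0 by rewrite -opprB oppr_eq0 polyXsubC_eq0.
apply: (mulfI (expf_neq0 2 u0)).
have := hpolyM square; rewrite square_rank subSS subSS subn0 => ->.
(* Inclusion-exclusion over the two antipodal pairs; the weights add up to (1 - t^2)^2. *)
have ind (F : {set 'I_4}) : (F \in faces square)%:R =
    ((set0 \subset F) && [disjoint set0 & F])%:R
    - (([set sq0; sq2] \subset F) && [disjoint set0 & F])%:R
    - (([set sq1; sq3] \subset F) && [disjoint set0 & F])%:R
    + (([set sq0; sq2] :|: [set sq1; sq3] \subset F) && [disjoint set0 & F])%:R :> {poly int}.
  rewrite sub0set -setI_eq0 set0I eqxx !andbT [_ :|: _ :|: _ \subset F]subUset inE.
  by case: ([set sq0; sq2] \subset F); case: ([set sq1; sq3] \subset F) => /=; ring.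
under eq_bigr => F _ do rewrite ind !(mulrDl, mulNr).
rewrite !big_split /= !sumrN !sum_face_weight ?disjoints_subset ?setC0 ?subsetT //.
rewrite cards0 !cards2 card_I4 !inE -!val_eqE /=; ring.
Qed.

End Square.

(** * Algebraic dependence in Stanley-Reisner rings of rank two *)

Section AlgebraicDependence.
Variables (K : fieldType) (n : nat).
Local Notation S := {mpoly K[n]}.

Lemma poly_lowest (T : nzRingType) (P : {poly T}) : P != 0 ->
  exists m c Q, c != 0 /\ P = 'X^m * (c%:P + Q * 'X).
Proof.
elim/poly_ind: P => [|p c IH]; first by rewrite eqxx.
have [->|c0 _] := eqVneq c 0; last by exists 0%N, c, p; rewrite expr0 mul1r addrC.
rewrite polyC0 addr0 => pX; have p0 : p != 0 by apply: contraNneq pX => ->; rewrite mul0r.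
have [m [c' [Q [c0 pE]]]] := IH p0; exists m.+1, c', Q; split=> //.
by rewrite exprSr -mulrA -(commr_polyX (_ + _)) mulrA -pE.
Qed.

Definition eval_at (A : nzRingType) (T : comNzRingType) (f : A -> T) (a : T) : {poly A} -> T :=
  horner_eval a \o map_poly f.

HB.instance Definition _ (A : nzRingType) (T : comNzRingType) (f : {rmorphism A -> T}) (a : T) :=
  GRing.RMorphism.copy (eval_at f a) (horner_eval a \o map_poly f).

Lemma eval_atC (A : nzRingType) (T : comNzRingType) (f : {rmorphism A -> T}) (a : T) (c : A) :
  eval_at f a c%:P = f c.
Proof. by rewrite /eval_at /= map_polyC /horner_eval hornerC. Qed.

Lemma eval_atX (A : nzRingType) (T : comNzRingType) (f : {rmorphism A -> T}) (a : T) :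
  eval_at f a 'X = a.
Proof. by rewrite /eval_at /= map_polyX /horner_eval hornerX. Qed.

Definition eval3 (a1 a2 a3 : S) : {poly {poly {poly K}}} -> S :=
  eval_at (eval_at (eval_at (@mpolyC n K) a3) a2) a1.

Lemma eval_at_lowest (A : nzRingType) (T : comNzRingType) (f : {rmorphism A -> T}) (a : T)
    (m : nat) (c : A) (Q : {poly A}) :
  eval_at f a ('X^m * (c%:P + Q * 'X)) = a ^+ m * (f c + eval_at f a Q * a).
Proof. by rewrite rmorphM rmorphXn rmorphD rmorphM /= eval_atC eval_atX. Qed.

(** Taking the lowest term in each of the three nested variables leaves a nonzero constant
    coefficient, which is then scaled to 1. *)
Lemma lex_of_dependence (I : idealr S) (a1 a2 a3 : S) (P : {poly {poly {poly K}}}) :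
  P != 0 -> eval3 a1 a2 a3 P \in (I : pred S) -> lex_relation I a1 a2 a3.
Proof.
move=> /poly_lowest [m1 [p1 [Q1 [p1_neq0 ->]]]]; rewrite /eval3 eval_at_lowest.
have [m2 [p2 [Q2 [p2_neq0 ->]]]] := poly_lowest p1_neq0; rewrite /= eval_at_lowest.
have [m3 [c [Q3 [c0 ->]]]] := poly_lowest p2_neq0; rewrite /= eval_at_lowest.
move: (eval_at _ a1 Q1) (eval_at _ a2 Q2) (eval_at _ a3 Q3) => x1 x2 x3 h.
exists m1, m2, m3, (c^-1%:MP * x1), (c^-1%:MP * x2), (c^-1%:MP * x3).
have cV : 1 = c^-1%:MP * c%:MP :> S by rewrite -rmorphM mulVf // rmorph1.
rewrite [X in X \in _](_ : _ = c^-1%:MP *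
  (a1 ^+ m1 * (a2 ^+ m2 * (a3 ^+ m3 * (c%:MP + x3 * a3) + x2 * a2) + x1 * a1))).
  exact: idealMr.
by rewrite [1 in LHS]cV; ring.
Qed.

Lemma msizeM_bound (p q : S) (s t : nat) : (msize p <= s.+1)%N -> (msize q <= t.+1)%N ->
  (msize (p * q) <= (s + t).+1)%N.
Proof.
move=> ps qt; have [->|p0] := eqVneq p 0; first by rewrite mul0r msize0.
have [->|q0] := eqVneq q 0; first by rewrite mulr0 msize0.
by rewrite msizeM //; have := leq_add ps qt; rewrite addSn addnS; case: (_ + _)%N.
Qed.

Lemma msizeX_bound (p : S) (s i : nat) : (msize p <= s.+1)%N -> (msize (p ^+ i) <= (i * s).+1)%N.
Proof.
move=> ps; elim: i => [|i IH]; first by rewrite expr0 msize1.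
by rewrite exprS mulSn; apply: msizeM_bound.
Qed.

Variable D : scomplex n.
Local Notation I := (sr_ideal D : idealr S).

Definition face_ffuns (M : nat) : {set {ffun 'I_n -> 'I_M}} :=
  [set e : {ffun 'I_n -> 'I_M} | supp_ffun e \in faces D].

Lemma card_face_ffuns (M : nat) : (#|face_ffuns M.+1| <= #|faces D| * M.+1 ^ rank D)%N.
Proof.
rewrite -sum1_card (partition_big (@supp_ffun n M.+1) (fun F => F \in faces D)) => [|e]; last by rewrite inE.
rewrite -sum_nat_const; apply: leq_sum => F FD; rewrite sum1_card.
apply: (@leq_trans (M.+1 ^ #|F|)); last by rewrite leq_pexp2l ?face_le_rank.
rewrite -[X in (_ <= X ^ _)%N](card_ord M.+1) -(card_pffun_on ord0) //.
apply: subset_leq_card; apply/subsetP => e; rewrite !inE => /andP [_ /eqP eF].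
apply/pffun_onP; split=> [|x _ //]; apply/subsetP => j.
by rewrite -eF !inE -val_eqE.
Qed.

Hypothesis rank2 : (rank D <= 2)%N.

(** There are L^3 products of powers of [a1], [a2], [a3], but in rank at most 2 only on the order of
    L^2 face-supported monomials of the degrees involved, so the products are dependent modulo the
    ideal. *)
Lemma sr_lex_relation (a1 a2 a3 : S) : lex_relation I a1 a2 a3.
Proof.
(* Degrees stay below M = 3LB + 1, which is at most L (3B + 1); [L] exceeds #|faces D| (3B + 1)^2 so
   that the L^3 products win. *)
pose B := maxn (msize a1) (maxn (msize a2) (msize a3)).
pose L := (#|faces D| * (3 * B).+1 ^ 2).+1.
pose M := (3 * (L * B)).+1.
pose J : finType := ('I_L * 'I_L * 'I_L)%type.
pose mon (t : J) : S := a1 ^+ t.1.1 * a2 ^+ t.1.2 * a3 ^+ t.2.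
have msz t : (msize (mon t) <= M)%N.
  have h (i : 'I_L) (a : S) : (msize a <= B)%N -> (msize (a ^+ i) <= (L * B).+1)%N.
    move=> aB; apply: leq_trans (msizeX_bound i (leqW aB)) _.
    by rewrite ltnS leq_mul2r (ltnW (ltn_ord i)) orbT.
  rewrite /M mulSn mul2n -addnn addnA.
  by apply: msizeM_bound; [apply: msizeM_bound|]; apply: h; rewrite /B !leq_max leqnn ?orbT.
have cJ : (#|face_ffuns M| < #|J|)%N.
  rewrite !card_prod !card_ord; apply: leq_ltn_trans (card_face_ffuns _) _.
  apply: (@leq_ltn_trans (#|faces D| * (L * (3 * B).+1) ^ 2)).
    rewrite leq_mul2l; apply/orP; right.
    apply: (@leq_trans (M ^ 2)); first by rewrite leq_pexp2l.
    by rewrite leq_exp2r // /M mulnS mulnCA -add1n leq_add2r.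
  rewrite expnMn mulnCA -mulnn ltn_pmul2l ?muln_gt0 //.
have [u u0 uA] := row_kernel (\matrix_(t < #|J|, e < #|face_ffuns M|)
  (mon (enum_val t))@_(mnm_of (enum_val e))) cJ.
pose c (t : J) : K := u 0 (enum_rank t).
pose P : {poly {poly {poly K}}} :=
  \sum_t ((((c t)%:P * 'X^(t.2))%:P * 'X^(t.1.2))%:P * 'X^(t.1.1)).
apply: (lex_of_dependence (P := P)).
  apply: contraNneq u0 => P0; apply/eqP/rowP => r; rewrite mxE.
  have : P`_(enum_val r).1.1`_(enum_val r).1.2`_(enum_val r).2 = c (enum_val r).
    rewrite !coef_sum (bigD1 (enum_val r)) //= big1 ?addr0 => [|t tr].
      by do 3!rewrite coefCM coefXn eqxx mulr1.
    rewrite coefCM coefXn.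
    have [e1|_] := eqVneq ((enum_val r).1.1 : nat) t.1.1; last by rewrite mulr0 !coef0.
    rewrite mulr1 coefCM coefXn.
    have [e2|_] := eqVneq ((enum_val r).1.2 : nat) t.1.2; last by rewrite mulr0 coef0.
    rewrite mulr1 coefCM coefXn.
    have [e3|_] := eqVneq ((enum_val r).2 : nat) t.2; last by rewrite mulr0.
    case/eqP: tr; move: e1 e2 e3; case: (enum_val r) => [[? ?] ?]; case: t => [[? ?] ?] /=.
    by move=> /val_inj -> /val_inj -> /val_inj ->.
  by rewrite P0 !coef0 /c enum_valK.
have evP : eval3 a1 a2 a3 P = \sum_t (c t)%:MP * mon t.
  rewrite /eval3 rmorph_sum; apply: eq_bigr => t _.
  rewrite rmorphM rmorphXn /= eval_atX eval_atC /=.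
  rewrite rmorphM rmorphXn /= eval_atX eval_atC /=.
  rewrite rmorphM rmorphXn /= eval_atX eval_atC /=.
  by rewrite /mon; move: (a1 ^+ _) (a2 ^+ _) (a3 ^+ _) => x y z; ring.
rewrite evP; apply/mem_sr_ideal => m mD.
rewrite raddf_sum /= (reindex (@enum_val J predT)) /=; last first.
  by exists enum_rank => ? _; rewrite ?enum_valK ?enum_rankK.
(* Above degree [M] no product contributes; below it, [m] indexes a column of the matrix killed by
   [u]. *)
have [mM|mM] := ltnP (mdeg m) M; last first.
  apply: big1 => r _; rewrite mcoeffCM (memN_msupp_eq0 (msize_mdeg_ge _)) ?mulr0 //.
  exact: leq_trans (msz _) mM.
have [e mE] := mnm_of_surj mM.
have eF : e \in face_ffuns M by rewrite inE -mnm_supp_of -mE.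
transitivity ((u *m (\matrix_(t < #|J|, e < #|face_ffuns M|)
  (mon (enum_val t))@_(mnm_of (enum_val e)))) 0 (enum_rank_in eF e)); last by rewrite uA mxE.
rewrite mxE; apply: eq_bigr => r _; rewrite mxE mcoeffCM enum_rankK_in // -mE.
by rewrite /c enum_valK.
Qed.

End AlgebraicDependence.

(** * Zariski's lemma for two generators *)

Lemma dvdp_det (K : fieldType) (e : nat) (f : {poly K}) (A B : 'M[{poly K}]_e) :
  (forall i j, f %| A i j - B i j) -> f %| \det A - \det B.
Proof.
move=> AB; rewrite /determinant -sumrB.
apply: (big_ind (fun x => f %| x)) => [|x y|s _]; [exact: dvdp0|exact: dvdp_add|].
rewrite -mulrBr dvdp_mull //; apply: (big_ind2 (fun x y => f %| x - y)) => //.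
  by rewrite subrr dvdp0.
move=> x1 x2 y1 y2 h1 h2; rewrite (_ : _ - _ = x1 * (y1 - y2) + (x1 - x2) * y2); last by ring.
exact: dvdp_add (dvdp_mull _ h2) (dvdp_mulr _ h1).
Qed.

(* If [K[X]] embeds in the field [L],
   take [Q] in the kernel with leading coefficient [l] and [f = 1 + X l];
   multiplication by [1 / f] on the span of the powers of [Y] gives a
   determinant showing that [f] divides a power of [l]. *)
Lemma algebraic_generator (K : fieldType) (L : comNzRingType)
    (psi : {rmorphism {poly {poly K}} -> L}) :
  (forall z, psi z != 0 -> exists w, psi (z * w) = 1) ->
  exists2 p : {poly K}, p != 0 & psi p%:P = 0.
Proof.
move=> inv; apply: contrapT => nalg.
have inj (p : {poly K}) : p != 0 -> psi p%:P != 0.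
  by move=> p0; apply/eqP => h; apply: nalg; exists p.
(* Inverting X yields the kernel element X g - 1, nonzero because its constant term is -1. It has
   positive degree in Y, since nonzero elements of K[X] do not vanish under [psi]. *)
have [g hg] := inv ('X%:P) (inj _ (negbT (polyX_eq0 K))).
pose Q := 'X%:P * g - 1.
have Qker : psi Q = 0 by rewrite rmorphB rmorph1 /= hg subrr.
have Q0 : Q != 0.
  apply/eqP => /(congr1 (fun P : {poly {poly K}} => P`_0`_0)) /eqP.
  by rewrite coefB coefCM coef1 coefB coefXM coef1 /= !coef0 sub0r oppr_eq0 oner_eq0.
have [e sQ] : exists e, size Q = e.+2.
  case sQ : (size Q) => [|[|e]]; last by exists e.
    by move/eqP: sQ; rewrite size_poly_eq0 (negPf Q0).
  have QC : Q = (Q`_0)%:P by apply: size1_polyC; rewrite sQ.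
  by move: Qker; rewrite QC => /eqP; rewrite (negPf (inj _ _)) // -polyC_eq0 -QC.
(* This [f] is nonconstant yet coprime to [l]. *)
pose l := lead_coef Q; pose f := 1 + 'X * l.
have l0 : l != 0 by rewrite lead_coef_eq0.
have sf : (1 < size f)%N.
  have sl : (0 < size l)%N by rewrite size_poly_gt0.
  by rewrite /f addrC size_polyDl mulrC size_mulX // ?size_poly1 ltnS.
have f0 : f != 0 by rewrite -size_poly_gt0 ltnW.
have [h hh] := inv f%:P (inj _ f0).
(* Pseudo-division by [Q] gives l^k h Y^i = r modulo the kernel. Multiplied by [f], the inverse of
   [h], it reads l^k Y^i = f r, which is row i of B v = 0. *)
pose r (i : 'I_e.+1) := (h * 'X^i) %% Q; pose k (i : 'I_e.+1) := scalp (h * 'X^i) Q.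
pose R : 'M[{poly K}]_e.+1 := \matrix_(i, j) (r i)`_j.
pose dg : 'rV[{poly K}]_e.+1 := \row_i (l ^+ k i).
pose B := diag_mx dg - f *: R.
pose phi : {rmorphism {poly K} -> L} := psi \o polyC.
pose v : 'cV[L]_e.+1 := \col_j psi 'X ^+ j.
have Bv : map_mx phi B *m v = 0.
  apply/colP => i; rewrite mxE [RHS]mxE.
  transitivity (\sum_j phi (diag_mx dg i j) * psi 'X ^+ j - phi f * \sum_j phi (R i j) * psi 'X ^+ j).
    rewrite mulr_sumr -sumrB; apply: eq_bigr => j _.
    by rewrite !mxE rmorphB [phi (f * _)]rmorphM mulrBl mulrA.
  rewrite (bigD1 i) //= [X in _ + X - _]big1 => [|j ji]; last first.
    by rewrite !mxE eq_sym (negPf ji) mulr0n polyC0 rmorph0 mul0r.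
  rewrite addr0 !mxE eqxx mulr1n.
  have -> : \sum_j psi (R i j)%:P * psi 'X ^+ j = psi (r i).
    have sr : (size (r i) <= e.+1)%N by have := ltn_modpN0 (h * 'X^i) Q0; rewrite sQ.
    rewrite -[in RHS](take_poly_id sr) /take_poly poly_def rmorph_sum; apply: eq_bigr => j _.
    by rewrite mxE -mul_polyC rmorphM rmorphXn.
  have := congr1 psi (Pdiv.WeakIdomain.divp_eq (h * 'X^i) Q).
  rewrite rmorphD [psi (_ * Q)]rmorphM Qker mulr0 add0r -/(r i) => <-.
  rewrite -/(k i) -/l -mul_polyC rmorphM rmorphM rmorphXn /=.
  rewrite rmorphM in hh; rewrite [X in _ - X](_ : _ = psi (f%:P) * psi h * (psi (l%:P ^+ k i) * psi 'X ^+ i)).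
    by rewrite hh mul1r subrr.
  rewrite [psi ('X^i)]rmorphXn; move: (psi 'X ^+ i) (psi (_ ^+ _)) => x y; ring.
(* The adjugate gives det(B) v = 0, and the first entry of [v] is 1. *)
have phi_det : phi (\det B) = 0.
  rewrite -det_map_mx; have := congr1 (mulmx (\adj (map_mx phi B))) Bv.
  rewrite mulmxA mul_adj_mx mul_scalar_mx mulmx0 => /colP /(_ 0).
  by rewrite !mxE expr0 mulr1.
have detB : \det B = 0.
  by apply/eqP; apply: contraT => /inj /eqP.
(* Modulo [f] the matrix [B] is diagonal, so its vanishing determinant is congruent to the product
   of the powers of [l]. *)
have fl : f %| \prod_i (l ^+ k i).
  have := dvdp_det (A := diag_mx dg) (B := B) (f := f); rewrite detB subr0 det_diag.
  rewrite (eq_bigr (fun i => l ^+ k i)) => [|i _]; last by rewrite mxE.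
  by apply=> i j; rewrite (_ : _ - _ = f * R i j) ?dvdp_mulr // !mxE subKr.
have cfl : coprimep f (\prod_i (l ^+ k i)).
  apply: (big_ind (fun x => coprimep f x)) => [|x y hx hy|i _]; first exact: coprimep1.
    by rewrite coprimepMr hx.
  apply: coprimep_expr; apply/Bezout_coprimepP; exists (1, - 'X) => /=.
  by rewrite /f mul1r mulNr addrK eqpxx.
by have := coprimep_dvdl fl cfl; rewrite coprimepp => /eqP sf1; rewrite sf1 in sf.
Qed.

(** * The 4-cycle is Cohen-Macaulay *)

Lemma rmorph_eval_at (A : nzRingType) (T U : comNzRingType) (f : {rmorphism A -> T})
    (g : {rmorphism T -> U}) (a : T) (p : {poly A}) :
  g (eval_at f a p) = eval_at (g \o f) (g a) p.
Proof. by rewrite /eval_at /= /horner_eval map_poly_comp horner_map. Qed.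

Lemma eq_eval_at (A : nzRingType) (T : comNzRingType) (f g : A -> T) (a : T) (p : {poly A}) :
  f =1 g -> eval_at f a p = eval_at g a p.
Proof. by move=> fg; rewrite /eval_at /= (eq_map_poly fg). Qed.

Lemma eval_at_polyX (A : nzRingType) (T : comNzRingType) (f : {rmorphism A -> T}) (p : {poly A}) :
  eval_at (polyC \o f) 'X p = map_poly f p.
Proof.
transitivity (map_poly f p \Po 'X); last exact: comp_polyXr.
by rewrite /eval_at /= /horner_eval /comp_poly -map_poly_comp.
Qed.

Lemma poly_domain (T : comNzRingType) : is_domain T -> is_domain {poly T}.
Proof.
move=> dT p q pq; apply: contraT; rewrite negb_or => /andP [p0 q0].
have l0 : lead_coef p * lead_coef q != 0.
  by apply/eqP => /dT; rewrite !lead_coef_eq0 (negPf p0) (negPf q0).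
have := size_proper_mul l0; rewrite pq size_poly0.
by move: p0 q0; rewrite -!size_poly_gt0; case: (size p) => // a; case: (size q) => // b; rewrite addnS.
Qed.

(** [T] may have zero divisors, but the leading coefficient stays invertible. *)
Lemma map_poly_regular (K : fieldType) (T : comNzRingType) (f : {rmorphism K -> T})
    (p : {poly K}) (q : {poly T}) :
  p != 0 -> map_poly f p * q = 0 -> q = 0.
Proof.
move=> p0 pq; have reg : GRing.lreg (map_poly f p).
  apply: lreg_lead; rewrite lead_coef_map; apply: (can_inj (g := *%R (f (lead_coef p)^-1))) => x.
  by rewrite mulrA -rmorphM mulVf ?lead_coef_eq0 // rmorph1 mul1r.
by apply: reg; rewrite pq mulr0.
Qed.

Lemma dim_ge_chain2 (R : comNzRingType) (p Q0 Q1 Q2 : prime_idealr R) (I : idealr R) :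
  {subset (I : pred R) <= (Q0 : pred R)} ->
  {subset (Q0 : pred R) <= (Q1 : pred R)} ->
  {subset (Q1 : pred R) <= (Q2 : pred R)} ->
  {subset (Q2 : pred R) <= (p : pred R)} ->
  (exists2 a, a \in (Q1 : pred R) & a \notin (Q0 : pred R)) ->
  (exists2 a, a \in (Q2 : pred R) & a \notin (Q1 : pred R)) ->
  dim_ge (A := loc_ring p) (localization p (cyclic_module I)) 2.
Proof.
move=> IQ0 Q01 Q12 Q2p [a a1 a0] [b b2 b1].
apply: (dim_ge_chain (Q := fun k : 'I_3 =>
  if val k is 0%N then Q0 else if val k is 1%N then Q1 else Q2)).
- by case=> [[|[|k]] lt] f /IQ0 //= /Q01 // /Q12.
- by case=> [[|[|k]] lt] f //= => [/Q01/Q12|/Q12|] /Q2p.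
case=> [[|[|[|//]]] lt] [[|[|[|//]]] lt'] //= _; split=> //.
- by exists a.
- by move=> f /Q01 /Q12.
- by exists a => //; apply: Q12.
by exists b.
Qed.

Section PairRegular.
Variables (K : fieldType) (n : nat).
Local Notation S := {mpoly K[n]}.
Variables (J : idealr S) (u v : 'I_n).

Definition quot_const : K -> {poly {ideal_quot J}} := polyC \o quot_pi J \o @mpolyC n K.
HB.instance Definition _ := GRing.RMorphism.copy quot_const (polyC \o quot_pi J \o @mpolyC n K).

(** This is the component X_v = 0 of X_u X_v = 0, with X_u made a free variable over the quotient by
    [J]; X_u + X_v becomes that variable. *)
Definition pair_subst : S -> {poly {ideal_quot J}} :=
  mmap quot_const (fun i => if i == u then 'X else if i == v then 0 else (quot_pi J 'X_i)%:P).
HB.instance Definition _ := GRing.RMorphism.copy pair_subst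
  (mmap quot_const (fun i => if i == u then 'X else if i == v then 0 else (quot_pi J 'X_i)%:P)).

Lemma pair_substX i : pair_subst 'X_i =
  if i == u then 'X else if i == v then 0 else (quot_pi J 'X_i)%:P.
Proof. by rewrite /pair_subst mmapX mmap1U. Qed.

Lemma pair_substC c : pair_subst c%:MP = (quot_pi J c%:MP)%:P.
Proof. exact: mmapC. Qed.

Hypothesis neq_uv : u != v.

Lemma pair_subst_horner f : (pair_subst f).[quot_pi J 'X_u] = quot_pi J (face_subst [set~ v] f).
Proof.
apply: (mpoly_rmorph_ext (f := horner_eval (quot_pi J 'X_u) \o pair_subst)
  (g := quot_pi J \o face_subst [set~ v])) => [c|i] /=.
  by rewrite face_substC pair_substC /horner_eval hornerC.
rewrite pair_substX face_substX !inE /horner_eval.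
have [->|iu] := eqVneq i u; first by rewrite neq_uv hornerX.
by case: eqP => _ /=; rewrite hornerC ?rmorph0.
Qed.

Lemma pair_subst_sum (p : {poly K}) :
  pair_subst (eval_at (@mpolyC n K) ('X_u + 'X_v) p) = map_poly (quot_pi J \o @mpolyC n K) p.
Proof.
rewrite rmorph_eval_at rmorphD /= !pair_substX eqxx eq_sym (negPf neq_uv) eqxx addr0.
rewrite -eval_at_polyX; apply: eq_eval_at => c.
exact: pair_substC.
Qed.

Lemma pair_substM f g : pair_subst (f * g) = pair_subst f * pair_subst g.
Proof. exact: rmorphM. Qed.

Lemma pair_substD f g : pair_subst (f + g) = pair_subst f + pair_subst g.
Proof. exact: rmorphD. Qed.

Lemma pair_subst_pair : pair_subst ('X_u * 'X_v) = 0.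
Proof. by rewrite pair_substM !pair_substX eqxx eq_sym (negPf neq_uv) eqxx mulr0. Qed.

Lemma pair_subst_off (k : 'I_n) : k != u -> k != v -> pair_subst 'X_k = (quot_pi J 'X_k)%:P.
Proof. by move=> /negPf ku /negPf kv; rewrite pair_substX ku kv. Qed.

Lemma pair_subst_fixedM f g : pair_subst f = (quot_pi J f)%:P -> pair_subst g = (quot_pi J g)%:P ->
  pair_subst (f * g) = (quot_pi J (f * g))%:P.
Proof. by move=> ef eg; rewrite pair_substM ef eg (rmorphM (quot_pi J)) polyCM. Qed.

Lemma pair_subst_fixedD f g : pair_subst f = (quot_pi J f)%:P -> pair_subst g = (quot_pi J g)%:P ->
  pair_subst (f + g) = (quot_pi J (f + g))%:P.
Proof. by move=> ef eg; rewrite pair_substD ef eg (rmorphD (quot_pi J)) polyCD. Qed.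

Lemma pair_subst_fixed_eval f (p : {poly K}) : pair_subst f = (quot_pi J f)%:P ->
  pair_subst (eval_at (@mpolyC n K) f p) = (quot_pi J (eval_at (@mpolyC n K) f p))%:P.
Proof.
move=> ef; have := rmorph_eval_at (@mpolyC n K) pair_subst f p => ->.
have := rmorph_eval_at (@mpolyC n K) (polyC \o quot_pi J) f p => /= ->.
by rewrite ef; apply: eq_eval_at => c; apply: pair_substC.
Qed.

Lemma pair_regular_subst (p : {poly K}) f : p != 0 ->
  pair_subst (eval_at (@mpolyC n K) ('X_u + 'X_v) p * f) = 0 ->
  face_subst [set~ v] f \in (J : pred S).
Proof.
move=> p0; rewrite rmorphM /= pair_subst_sum => /(map_poly_regular p0) h.
by rewrite -quot_pi_eq0 -pair_subst_horner h horner0.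
Qed.

Lemma face_subst_stable f : (forall g, g \in (J : pred S) -> pair_subst g = 0) ->
  f \in (J : pred S) -> face_subst [set~ v] f \in (J : pred S).
Proof. by move=> kill fJ; rewrite -quot_pi_eq0 -pair_subst_horner kill ?horner0. Qed.

End PairRegular.

Lemma face_subst_setC1 (K : fieldType) (n : nat) (v : 'I_n) (f : {mpoly K[n]}) :
  exists c, f - face_subst [set~ v] f = c * 'X_v.
Proof.
have [c ->] := face_subst_diff [set~ v] f; exists (c v).
by rewrite (big_pred1 v) // => i; rewrite !inE negbK.
Qed.

(* Modulo [X_u X_v], an element is recovered from its reductions modulo [X_u]
   and modulo [X_v], and on each of them [p (X_u + X_v)] is a polynomial in a
   single free variable. *)
Lemma pair_regular (K : fieldType) (n : nat) (J : idealr {mpoly K[n]}) (u v : 'I_n)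
    (p : {poly K}) (f : {mpoly K[n]}) :
  u != v -> 'X_u * 'X_v \in (J : pred {mpoly K[n]}) ->
  (forall g, g \in (J : pred {mpoly K[n]}) -> pair_subst J u v g = 0) ->
  (forall g, g \in (J : pred {mpoly K[n]}) -> pair_subst J v u g = 0) ->
  p != 0 -> eval_at (@mpolyC n K) ('X_u + 'X_v) p * f \in (J : pred {mpoly K[n]}) ->
  f \in (J : pred {mpoly K[n]}).
Proof.
move=> uv uvJ killu killv p0 pf; have vu : v != u by rewrite eq_sym.
have fv := pair_regular_subst uv p0 (killu _ pf).
have fu : face_subst [set~ u] f \in (J : pred {mpoly K[n]}).
  by apply: (pair_regular_subst vu p0); apply: killv; rewrite addrC.
have fuv := face_subst_stable vu killv fv.
have [c fE] := face_subst_setC1 v f; have [c' cE] := face_subst_setC1 u c.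
have e : face_subst [set~ u] f - face_subst [set~ u] (face_subst [set~ v] f) = face_subst [set~ u] c * 'X_v.
  by rewrite -rmorphB fE rmorphM /= face_substX !inE vu.
(* Restrict to X_v = 0, add the restriction to X_u = 0, and subtract the common part; the rest is
   divisible by X_u X_v. *)
have -> : f = face_subst [set~ v] f + (face_subst [set~ u] f - face_subst [set~ u] (face_subst [set~ v] f))
    + c' * ('X_u * 'X_v).
  rewrite e -{1}(subrK (face_subst [set~ v] f) f) fE -{1}(subrK (face_subst [set~ u] c) c) cE.
  by ring.
exact: rpredD (rpredD fv (rpredB fu fuv)) (idealMr _ uvJ).
Qed.

Section SquareCM.
Variables (K : fieldType) (m : prime_idealr {mpoly K[4]}).
Local Notation S := {mpoly K[4]}.
Local Notation I := (sr_ideal square : idealr S).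
Hypothesis m_max : maximal_ideal m.
Hypothesis Im : {subset (I : pred S) <= (m : pred S)}.
Local Notation C := (@mpolyC 4 K).

(* [i'] and [j'] are antipodal to [i] and [j]. *)
Variables (i i' j j' : 'I_4).
Hypothesis ijD : [set i; j] \in faces square.
Hypothesis ii'I : 'X_i * 'X_i' \in (I : pred S).
Hypothesis jj'I : 'X_j * 'X_j' \in (I : pred S).
Hypothesis I_gen : forall (T : comNzRingType) (g : {rmorphism S -> T}),
  g ('X_i * 'X_i') = 0 -> g ('X_j * 'X_j') = 0 -> forall f, f \in (I : pred S) -> g f = 0.
Hypothesis neq : [&& i != i', i != j, i != j', i' != j, i' != j' & j != j'].
Hypothesis cover : forall k, k \in [:: i; i'; j; j'].
Hypothesis i'm : 'X_i' \in (m : pred S).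
Hypothesis j'm : 'X_j' \in (m : pred S).

Let theta : S := 'X_i + 'X_i'.
Let eta : S := 'X_j + 'X_j'.

(** X_i' and X_j' vanish modulo [m], so the residue field is generated by [theta] and [eta]. *)
Lemma square_back_mod : exists back : {rmorphism S -> {poly {poly K}}},
  forall a, eval_at (eval_at (quot_pi m \o C) (quot_pi m theta)) (quot_pi m eta) (back a) = quot_pi m a.
Proof.
case/and5P: neq => ii' ij ij' i'j /andP [i'j' jj'].
pose h (k : 'I_4) : {poly {poly K}} := if k == i then 'X%:P else if k == j then 'X else 0.
exists (mmap (polyC \o polyC) h) => a.
apply: (mpoly_rmorph_ext (f := eval_at (eval_at (quot_pi m \o C) (quot_pi m theta)) (quot_pi m eta)
  \o mmap (polyC \o polyC) h) (g := quot_pi m)) => [c|k] /=.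
  by rewrite mmapC /= eval_atC /= eval_atC.
have [i'0 j'0] : quot_pi m 'X_i' = 0 /\ quot_pi m 'X_j' = 0 by split; apply/eqP; rewrite quot_pi_eq0.
rewrite mmapX mmap1U /h; have := cover k; rewrite !inE => /or4P [] /eqP ->.
- by rewrite eqxx eval_atC /= eval_atX rmorphD /= i'0 addr0.
- by rewrite eq_sym (negPf ii') (negPf i'j) rmorph0 i'0.
- by rewrite eq_sym (negPf ij) eqxx eval_atX rmorphD /= j'0 addr0.
by rewrite eq_sym (negPf ij') eq_sym (negPf jj') rmorph0 j'0.
Qed.

Lemma square_algebraic : exists2 p : {poly K}, p != 0 & eval_at C theta p \in (m : pred S).
Proof.
have [back backE] := square_back_mod.
have [|p p0] := @algebraic_generator K _
    (eval_at (eval_at (quot_pi m \o C) (quot_pi m theta)) (quot_pi m eta)).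
  move=> z z0; have [a aE] := quot_pi_surj (eval_at (eval_at (quot_pi m \o C) (quot_pi m theta)) (quot_pi m eta) z).
  have {}z0 : a \notin (m : pred S) by rewrite -quot_pi_eq0 -aE.
  have [c hc] := maximal_inv m_max z0.
  exists (back c); rewrite rmorphM /= backE aE mulrC -rmorphM /=; apply/eqP.
  by rewrite -subr_eq0 -(rmorph1 (quot_pi m)) -rmorphB quot_pi_eq0 -opprB rpredN.
rewrite /= eval_atC => h; exists p => //.
by rewrite -quot_pi_eq0 rmorph_eval_at h.
Qed.

(** Between the prime of the edge and [m] lies the prime that specializes X_i to its residue and
    keeps X_j free: it contains p(theta) but not q(eta). *)
Lemma square_dim_ge2 (p q : {poly K}) : p != 0 -> eval_at C theta p \in (m : pred S) ->
  q != 0 -> eval_at C eta q \in (m : pred S) ->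
  dim_ge (A := loc_ring m) (localization m (sr_ring K square)) 2.
Proof.
case/and5P: neq => ii' ij ij' i'j /andP [i'j' jj'] p0 pm q0 qm.
have [i'0 j'0] : quot_pi m 'X_i' = 0 /\ quot_pi m 'X_j' = 0 by split; apply/eqP; rewrite quot_pi_eq0.
pose h (k : 'I_4) : {poly {ideal_quot m}} := if k == i then (quot_pi m 'X_i)%:P else if k == j then 'X else 0.
pose g : {rmorphism S -> {poly {ideal_quot m}}} := mmap (polyC \o quot_pi m \o C) h.
have gX k : g 'X_k = h k by rewrite [LHS]mmapX mmap1U.
have gC c : g c%:MP = (quot_pi m c%:MP)%:P by rewrite [LHS]mmapC.
have [gi gi' gj gj'] : [/\ g 'X_i = (quot_pi m 'X_i)%:P, g 'X_i' = 0, g 'X_j = 'X & g 'X_j' = 0].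
  rewrite !gX /h !eqxx (eq_sym i') (negPf ii') (negPf i'j) (eq_sym j i) (negPf ij).
  by rewrite (eq_sym j' i) (negPf ij') (eq_sym j' j) (negPf jj').
pose P1 := ker_prime g (poly_domain (@quot_domain _ m)).
have geval f : (g f).[quot_pi m 'X_j] = quot_pi m f.
  apply: (mpoly_rmorph_ext (f := horner_eval (quot_pi m 'X_j) \o g) (g := quot_pi m)) => [c|k] /=.
    by rewrite gC /horner_eval hornerC.
  rewrite /horner_eval; have := cover k; rewrite !inE => /or4P [] /eqP ->.
  - by rewrite gi hornerC.
  - by rewrite gi' horner0 i'0.
  - by rewrite gj hornerX.
  by rewrite gj' horner0 j'0.
have P1m : {subset (P1 : pred S) <= (m : pred S)}.
  by move=> f /eqP fP; rewrite -quot_pi_eq0 -geval fP horner0.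
have P01 : {subset (face_prime K [set i; j] : pred S) <= (P1 : pred S)}.
  move=> f /face_primeP [c ->]; rewrite rpred_sum // => k; rewrite !inE negb_or => /andP [ki kj].
  by apply: idealMr; rewrite mem_ker_prime gX /h (negPf ki) (negPf kj).
have gtheta : g theta = (quot_pi m theta)%:P by rewrite !rmorphD /= gi gi' i'0 !addr0.
have pP1 : eval_at C theta p \in (P1 : pred S).
  rewrite mem_ker_prime rmorph_eval_at gtheta.
  rewrite (eq_eval_at (g := (polyC \o quot_pi m) \o C)) //.
  have <- := rmorph_eval_at C (polyC \o quot_pi m) theta p.
  by rewrite /= polyC_eq0 quot_pi_eq0.
(* Sending X_i to a variable and all other X_k to 0 turns p(theta) back into [p]. *)
have pP0 : eval_at C theta p \notin (face_prime K [set i; j] : pred S).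
  rewrite mem_face_prime; apply: contraNneq p0 => fp0.
  pose r : {rmorphism S -> {poly K}} := mmap polyC (fun k => if k == i then 'X else 0).
  have rtheta : (r \o face_subst [set i; j]) theta = 'X.
    rewrite rmorphD /= !face_substX !inE eqxx (eq_sym i') (negPf ii') (negPf i'j) rmorph0 addr0.
    by rewrite [LHS]mmapX mmap1U eqxx.
  have : r (face_subst [set i; j] (eval_at C theta p)) =
      eval_at ((r \o face_subst [set i; j]) \o C) 'X p.
    by rewrite -rtheta; exact: (rmorph_eval_at C (r \o face_subst [set i; j]) theta p).
  rewrite fp0 rmorph0 (eq_eval_at (g := polyC)) => [e|c]; last first.
    by rewrite /= face_substC [LHS]mmapC.
  by rewrite -[p]comp_polyXr; apply/eqP/esym.
have qP1 : eval_at C eta q \notin (P1 : pred S).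
  rewrite mem_ker_prime rmorph_eval_at rmorphD /= gj gj' addr0.
  rewrite (eq_eval_at (g := polyC \o (quot_pi m \o C))) => [|c]; last exact: gC.
  by rewrite eval_at_polyX map_poly_eq0.
apply: (dim_ge_chain2 (Q0 := face_prime K [set i; j]) (Q1 := P1) (Q2 := m)) => //.
- exact: sr_ideal_face.
- by exists (eval_at C theta p).
- by exists (eval_at C eta q).
Qed.

(** [pair_regular] is used for the pair i, i' over [I], then for j, j' over [I] enlarged by
    p(theta). The latter does not involve X_j or X_j', so it remains a constant that vanishes in the
    quotient. *)
Lemma square_depth_ge2 (p q : {poly K}) : p != 0 -> eval_at C theta p \in (m : pred S) ->
  q != 0 -> eval_at C eta q \in (m : pred S) ->
  depth_ge (A := loc_ring m) (localization m (sr_ring K square)) 2.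
Proof.
case/and5P: neq => ii' ij ij' i'j /andP [i'j' jj'] p0 pm q0 qm.
have proper c : 1 - c * eval_at C theta p \notin (I : pred S).
  apply/negP => /Im h; have := idealr1 m.
  by rewrite -(subrK (c * eval_at C theta p) 1) rpredD // idealMr.
pose J := adjoin proper.
have IJ f : f \in (I : pred S) -> f \in (J : pred S).
  by move=> fI; apply/mem_adjoin; exists 0; rewrite mul0r subr0.
have pJ : eval_at C theta p \in (J : pred S).
  by apply/mem_adjoin; exists 1; rewrite mul1r subrr idealr0.
have killI (u v : 'I_4) : u != v -> 'X_u * 'X_v = 'X_i * 'X_i' :> S ->
    [/\ j != u, j != v, j' != u & j' != v] ->
    forall f, f \in (I : pred S) -> pair_subst I u v f = 0.
  move=> uv uvE [ju jv j'u j'v] f fI; refine (@I_gen _ (pair_subst I u v) _ _ f fI).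
    by rewrite -uvE; apply: pair_subst_pair.
  apply: etrans (pair_subst_fixedM (pair_subst_off I ju jv) (pair_subst_off I j'u j'v)) _.
  by apply/eqP; rewrite polyC_eq0 quot_pi_eq0.
have killJ (u v : 'I_4) : u != v -> 'X_u * 'X_v = 'X_j * 'X_j' :> S ->
    [/\ i != u, i != v, i' != u & i' != v] ->
    forall f, f \in (J : pred S) -> pair_subst J u v f = 0.
  move=> uv uvE [iu iv i'u i'v] f /mem_adjoin [c hc].
  have fi := pair_subst_off J iu iv; have fi' := pair_subst_off J i'u i'v.
  have kp : pair_subst J u v (eval_at C theta p) = 0.
    apply: etrans (pair_subst_fixed_eval p (pair_subst_fixedD fi fi')) _.
    by apply/eqP; rewrite polyC_eq0 quot_pi_eq0.
  rewrite -[f](subrK (c * eval_at C theta p)) pair_substD pair_substM kp mulr0 addr0.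
  refine (@I_gen _ (pair_subst J u v) _ _ _ hc); last by rewrite -uvE; apply: pair_subst_pair.
  apply: etrans (pair_subst_fixedM fi fi') _.
  by apply/eqP; rewrite polyC_eq0 quot_pi_eq0 IJ.
have i'i : i' != i by rewrite eq_sym.
have j'j : j' != j by rewrite eq_sym.
have [ji ji' j'i j'i'] : [/\ j != i, j != i', j' != i & j' != i'] by rewrite !(eq_sym j) !(eq_sym j').
apply: (depth_ge2_intro Im pm qm) => [f|f c h].
  by apply: (pair_regular ii') => //; apply: killI => //; rewrite mulrC.
apply/(mem_adjoin proper)/(pair_regular (J := J) jj' (IJ _ jj'I) _ _ q0).
- exact: killJ.
- by apply: killJ; rewrite // mulrC.
by apply/mem_adjoin; exists c.
Qed.

End SquareCM.

Lemma square_ideal_gen (K : fieldType) (T : comNzRingType) (g : {rmorphism {mpoly K[4]} -> T}) :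
  g ('X_sq0 * 'X_sq2) = 0 -> g ('X_sq1 * 'X_sq3) = 0 ->
  forall f, f \in (sr_ideal square : idealr {mpoly K[4]}) -> g f = 0.
Proof.
move=> g02 g13 f /asboolP [c ->]; rewrite rmorph_sum big1 //= => F FD.
have kill (u v : 'I_4) : u != v -> u \in F -> v \in F -> g ('X_u * 'X_v) = 0 ->
    g (c F * \prod_(k in F) 'X_k) = 0.
  move=> uv uF vF guv; rewrite (bigD1 u) //= (bigD1 v) ?vF 1?eq_sym //=.
  move: (\prod_(_ | _) _) => R; rewrite (_ : _ * _ = c F * R * ('X_u * 'X_v)); last by ring.
  by rewrite rmorphM guv mulr0.
move: FD; rewrite [_ \in _]mem_square negb_and !negbK => /orP [] /andP [uF vF].
  exact: kill uF vF g02.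
exact: kill uF vF g13.
Qed.

Lemma square_dim_depth2 (K : fieldType) (m : prime_idealr {mpoly K[4]}) :
  maximal_ideal m ->
  {subset (sr_ideal square : pred {mpoly K[4]}) <= (m : pred {mpoly K[4]})} ->
  dim_ge (A := loc_ring m) (localization m (sr_ring K square)) 2 /\
  depth_ge (A := loc_ring m) (localization m (sr_ring K square)) 2.
Proof.
move=> mmax Im.
have core (i i' j j' : 'I_4) : [set i; j] \in faces square ->
    'X_i * 'X_i' \in (sr_ideal square : pred {mpoly K[4]}) ->
    'X_j * 'X_j' \in (sr_ideal square : pred {mpoly K[4]}) ->
    (forall (T : comNzRingType) (g : {rmorphism {mpoly K[4]} -> T}),
      g ('X_i * 'X_i') = 0 -> g ('X_j * 'X_j') = 0 ->
      forall f, f \in (sr_ideal square : pred {mpoly K[4]}) -> g f = 0) ->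
    [&& i != i', i != j, i != j', i' != j, i' != j' & j != j'] ->
    (forall k, k \in [:: i; i'; j; j']) ->
    'X_i' \in (m : pred {mpoly K[4]}) -> 'X_j' \in (m : pred {mpoly K[4]}) ->
    dim_ge (A := loc_ring m) (localization m (sr_ring K square)) 2 /\
    depth_ge (A := loc_ring m) (localization m (sr_ring K square)) 2.
  move=> ijD ii'I jj'I gen neq cover i'm j'm.
  have [p p0 pm] := square_algebraic mmax neq cover i'm j'm.
  (* The two antipodal pairs exchange roles. *)
  have [q q0 qm] : exists2 q : {poly K}, q != 0 & eval_at (@mpolyC 4 K) ('X_j + 'X_j') q \in (m : pred {mpoly K[4]}).
    apply: (square_algebraic mmax (i := j) (i' := j') (j := i) (j' := i')) => //.
      by move: neq; rewrite !(eq_sym j) !(eq_sym j'); do 6!case: (_ == _).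
    by move=> k; have := cover k; rewrite !inE; do 4!case: (_ == _).
  by split; [apply: (square_dim_ge2 ijD neq cover i'm j'm p0 pm q0 qm)
    |apply: (square_depth_ge2 Im ii'I jj'I gen neq p0 pm q0 qm)].
have prodI (u v : 'I_4) : u != v -> [set u; v] \notin faces square ->
    'X_u * 'X_v \in (sr_ideal square : pred {mpoly K[4]}).
  by move=> uv /(sr_ideal_gen K); rewrite big_setU1 ?inE // big_set1.
have I02 : 'X_sq0 * 'X_sq2 \in (sr_ideal square : pred {mpoly K[4]}).
  by apply: prodI => //; rewrite [_ \in _]mem_square !inE.
have I13 : 'X_sq1 * 'X_sq3 \in (sr_ideal square : pred {mpoly K[4]}).
  by apply: prodI => //; rewrite [_ \in _]mem_square !inE.
have [I20 I31] : 'X_sq2 * 'X_sq0 \in (sr_ideal square : pred {mpoly K[4]}) /\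
    'X_sq3 * 'X_sq1 \in (sr_ideal square : pred {mpoly K[4]}).
  by rewrite !(mulrC _ 'X_sq0, mulrC _ 'X_sq1).
have cov (k : 'I_4) : [|| k == sq0, k == sq2, k == sq1 | k == sq3].
  by case: k => [[|[|[|[|]]]]].
have := Im _ I02; have := Im _ I13; rewrite !prime_idealrM.
have gen (u u' v v' : 'I_4) :
    'X_u * 'X_u' = 'X_sq0 * 'X_sq2 :> {mpoly K[4]} -> 'X_v * 'X_v' = 'X_sq1 * 'X_sq3 :> {mpoly K[4]} ->
    forall (T : comNzRingType) (g : {rmorphism {mpoly K[4]} -> T}),
      g ('X_u * 'X_u') = 0 -> g ('X_v * 'X_v') = 0 ->
      forall f, f \in (sr_ideal square : pred {mpoly K[4]}) -> g f = 0.
  by move=> -> -> T g; apply: square_ideal_gen.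
(* The prime [m] contains a variable of each antipodal pair; the four choices differ by
   relabelling. *)
case/orP => h13; case/orP => h02.
- apply: (core sq2 sq0 sq3 sq1) => //; first by rewrite [_ \in _]mem_square !inE.
    by apply: gen; rewrite // mulrC.
  by move=> k; have := cov k; rewrite !inE; do 4!case: (_ == _).
- apply: (core sq0 sq2 sq3 sq1) => //; first by rewrite [_ \in _]mem_square !inE.
    by apply: gen; rewrite // mulrC.
  by move=> k; have := cov k; rewrite !inE; do 4!case: (_ == _).
- apply: (core sq2 sq0 sq1 sq3) => //; first by rewrite [_ \in _]mem_square !inE.
    by apply: gen; rewrite // mulrC.
  by move=> k; have := cov k; rewrite !inE; do 4!case: (_ == _).
apply: (core sq0 sq2 sq1 sq3) => //; first by rewrite [_ \in _]mem_square !inE.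
  by apply: gen.
by move=> k; have := cov k; rewrite !inE; do 4!case: (_ == _).
Qed.

Lemma square_cm (K : fieldType) : cm_complex K square.
Proof.
move=> m mmax k.
have [Im|nIm] := pselect {subset (sr_ideal square : pred {mpoly K[4]}) <= (m : pred {mpoly K[4]})}.
  have [dim2 depth2] := square_dim_depth2 mmax Im.
  have lex := sr_lex_relation (K := K) (eq_leq square_rank).
  have [k2|k3] := leqP k 2.
    by split=> _; [apply: dim_geW k2 dim2|apply: depth_geW k2 depth2].
  by split=> [/(depth_geW k3)|/(dim_geW k3)] h; exfalso; [apply: lex_depth_lt3 h|apply: lex_dim_lt3 h].
(* Here [f] is a unit at [m] that kills the module, so the localization is 0 and both conditions
   fail for every [k]. *)
have [f fI fm] : exists2 f, f \in (sr_ideal square : pred {mpoly K[4]}) & f \notin (m : pred {mpoly K[4]}).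
  by apply: contrapT => h; apply: nIm => f fI; apply: contrapT => /negP fm; apply: h; exists f.
split=> [/(depth_geW (leq0n k)) /depth_ge_loc [t [t0 _ _ [x hx]]]|/(dim_geW (leq0n k)) [P [Pann _]]]; exfalso.
  by apply: hx; case: t t0 => // _; exists f => //; rewrite mulrC; apply: idealMr.
suff h1 : 1 \in (P ord0 : pred _) by rewrite idealr1 in h1.
apply: Pann => y; have [x [t ->]] := mkfrac_surj_cyclic y.
rewrite scale1r; apply/mkfrac_eq0; exists f => //.
by rewrite mulrC; apply: idealMr.
Qed.

(** * Numerical conditions and conclusion *)

Lemma sum_bin_ge (i e : nat) : (i <= 2)%N -> (3 <= e)%N ->
  ('C(i + e, i) <= \sum_(k < e) 'C(i + k, i))%N.
Proof.
move=> i2; elim: e => // e IH; rewrite leq_eqVlt => /orP [/eqP <-|e3].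
  (* The case i = 2 is the equality 10 = 1 + 3 + 6, which corresponds to d = 5. *)
  by case: i i2 {IH} => [|[|[|//]]] _; rewrite !big_ord_recl big_ord0.
have {}IH := IH e3; rewrite big_ord_recr /= addnS.
move: (\sum_(_ < e) _)%N IH => s; case: i i2 => [|[|[|//]]] _; first by rewrite !bin0; lia.
  by rewrite !bin1; lia.
rewrite !add2n => IH; rewrite binS addnC bin1 leq_add2r (leq_trans _ IH) //.
rewrite binS bin1 -add1n leq_add2r bin_gt0; lia.
Qed.

Definition star_h (d i : nat) : int := if i == 1%N then 2 else if i == d then -1 else 1.

Lemma star_hpoly_coef (d : nat) (d5 : (5 <= d)%N) (i : nat) :
  (hpoly (star_complex d5))`_i = if (i < d.+1)%N then star_h d i else 0.
Proof.
rewrite star_hpoly // coefD coefB coefZ coefX coefXn.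
have -> : \sum_(k < d.+1) 'X^k = \poly_(k < d.+1) 1 :> {poly int}.
  by rewrite poly_def; apply: eq_bigr => k _; rewrite scale1r.
rewrite coef_poly /star_h; case: ltnP => id.
  have [->|i1] := eqVneq i 1%N; first by rewrite (_ : (1%N == d) = false) //; apply/eqP; lia.
  by case: eqP.
have [-> ->] : (i == 1%N) = false /\ (i == d) = false by split; apply/eqP; lia.
by [].
Qed.

Theorem theorem1p2 (K : fieldType) (d : nat) (hd : (5 <= d)%N) :
  exists h : d.+1.-tuple int,
    [/\ forall i : 'I_d.+1, tnth h i != 0,
        exists (n : nat) (D : scomplex n), pure D /\ is_h_vector K D h,
        M_vector K [:: h`_0; h`_1; h`_2],
        forall i : nat, (i <= 2)%N ->
          0 <= \sum_(2 <= j < d.+1) 'C(i + j - 2, i)%:Z * h`_j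
      & ~ exists (n : nat) (D : scomplex n),
          [/\ sc_dim D = d%:Z - 1, serre_complex K D 2 & is_h_vector K D h]].
Proof.
pose h := [tuple star_h d i | i < d.+1]; exists h.
have hE i : h`_i = if (i < d.+1)%N then star_h d i else 0.
  case: ltnP => id; first by rewrite -[i]/(val (Ordinal id)) nth_mktuple.
  by rewrite nth_default ?size_tuple.
have szh : size h = d.+1 by rewrite size_tuple.
split.
- by move=> i; rewrite tnth_mktuple /star_h; case: ifP => // _; case: ifP.
- exists d.+2, (star_complex hd); split; first exact: star_pure.
  apply/is_h_vectorP; split; first by rewrite szh star_rank.
  by move=> i; rewrite hE star_hpoly_coef.
- exists 4, square; split; first exact: square_cm.
  apply/is_h_vectorP; rewrite square_rank !hE /star_h; split=> // i.
  have [e0 e2] : (0%N == d) = false /\ (2%N == d) = false by split; apply/eqP; lia.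
  have [l1 l2] : (1 < d.+1)%N /\ (2 < d.+1)%N by split; lia.
  rewrite ltn0Sn l1 l2 e0 e2 /=.
  rewrite square_hpoly !coefD coef1 mulr_natl coefMn coefX coefXn.
  by case: i => [|[|[|i]]] //=; rewrite nth_nil.
(* The negative last term is split off; with j = k + 2 the others are compared to it for e = d -
   2. *)
- move=> i i2; rewrite big_nat_recr /=; last by lia.
  rewrite hE ltnSn /star_h (_ : (d == 1%N) = false) ?eqxx; last by apply/eqP; lia.
  rewrite mulrN1 subr_ge0.
  have -> : (i + d - 2 = i + (d - 2))%N by lia.
  rewrite -[2%N]add0n big_addn add0n.
  rewrite (eq_big_nat _ _ (F2 := fun k => 'C(i + k, i)%:Z)) => [|k /andP [_ kd]].
    by rewrite big_mkord -rmorph_sum /= lez_nat; apply: sum_bin_ge => //; lia.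
  rewrite addnA addnK hE (_ : k + 2 < d.+1)%N; last by lia.
  have [k1 kd'] : (k + 2 == 1)%N = false /\ (k + 2 == d)%N = false by split; apply/eqP; lia.
  by rewrite /star_h k1 kd' mulr1.
case=> n [D [_ S2 /is_h_vectorP [sz hp]]].
have rD : rank D = d by move: sz; rewrite szh => -[].
have hpD : hpoly D = hpoly (star_complex hd).
  by apply/polyP => i; rewrite -hp hE star_hpoly_coef.
(* At t = 1 the polynomial takes the value 1 - 2 + (d + 1) = d. *)
have cF : #|[set F in faces D | #|F| == rank D]| = d.
  apply/eqP; rewrite -eqz_nat -hpoly1 hpD star_hpoly // !hornerE expr1n mulr1.
  rewrite horner_sum (eq_bigr (fun=> 1)) => [|i _]; last by rewrite hornerXn expr1n.
  by rewrite sumr_const card_ord -natz; apply/eqP; lia.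
have [|v vF] := serre2_common_vertex S2; first by rewrite cF rD.
have := hpoly_cone vF; rewrite -hp rD hE ltnSn /star_h eqxx (_ : (d == 1%N) = false) //.
by apply/eqP; lia.
Qed.
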